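(* The standard metric $g_s$ on $F(5)=\mathrm{SU}(5)/T^4$, i.e. the $\mathrm{SU}(5)$-invariant Einstein metric with $x_{ij}=1$ for all $1\le i<j\le5$, is $G$-non-degenerate, $G$-unstable, and its coindex is $4$.
   Context: $F(n)=\mathrm{SU}(n)/T^{n-1}$, where $T=T^{n-1}$ is the diagonal maximal torus with Lie algebra $\mathfrak{t}$; $G=\mathrm{SU}(n)$. Let $Q=-B$ be minus the Killing form of $\mathfrak{su}(n)$. There is a $Q$-orthogonal decomposition $\mathfrak{su}(n)=\mathfrak{t}\oplus\bigoplus_{1\le i<j\le n}\mathfrak{p}_{ij}$, where $\mathfrak{p}_{ij}$ is the 2-dimensional space of skew-Hermitian matrices whose only nonzero entries are in positions $(i,j)$ and $(j,i)$; the $\mathfrak{p}_{ij}$ are irreducible and pairwise inequivalent under $\mathrm{Ad}(T)$. Hence every $G$-invariant metric on $F(n)$ is determined by $g=\sum_{i<j}x_{ij}\,Q|_{\mathfrak{p}_{ij}}$ on $\mathfrak{p}=\bigoplus\mathfrak{p}_{ij}\cong T_oF(n)$ with $x_{ij}>0$, and is denoted by the tuple $(x_{ij})$ in lexicographic order. Stability notions. Let $\mathcal M_1^G$ be the manifold of unit-volume $G$-invariant metrics. A metric $g\in\mathcal M_1^G$ is Einstein ($\mathrm{Rc}(g)=\rho g$) iff it is a critical point of the scalar curvature functional $\mathrm{Sc}:\mathcal M_1^G\to\mathbb R$. Let $\mathrm{Sc}''_g$ be the Hessian at such $g$, restricted to the space $\mathcal{TT}_g^G$ of $G$-invariant traceless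 divergence-free symmetric 2-tensors (here equal to $T_g\mathcal M_1^G$, the $G$-invariant $g$-traceless symmetric 2-tensors). The Einstein metric $g$ is $G$-unstable if $\mathrm{Sc}''_g(T,T)>0$ for some $T\in\mathcal{TT}_g^G$, and $G$-non-degenerate if $\mathrm{Sc}''_g|_{\mathcal{TT}_g^G}$ is non-degenerate; its coindex is the maximal dimension of a subspace of $\mathcal{TT}_g^G$ on which $\mathrm{Sc}''_g$ is positive definite. For Einstein metrics not of unit volume, these notions refer to the unit-volume rescaling. *)

(* Defs.v *)
From mathcomp Require Import all_boot all_order all_algebra.
From mathcomp Require Import all_classical all_reals all_analysis.
From mathcomp Require Import complex.

Set Implicit Arguments.
Unset Strict Implicit.
Unset Printing Implicit Defensive.

Import Order.TTheory GRing.Theory Num.Theory.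
Import numFieldNormedType.Exports.
Local Open Scope ring_scope.
Local Open Scope complex_scope.

(* The real Lie algebra su(n) is described by an explicit real basis indexed by
   the pairs (i, j) : 'I_n * 'I_n other than (n-1, n-1):
     i < j : E_ij - E_ji           (real part of p_ij),
     j < i : 'i (E_ij + E_ji)      (imaginary part of p_ji),
     i = j : 'i (E_ii - E_(n-1,n-1))   (diagonal part t);
   su_coord ij Z is the corresponding coordinate of a traceless skew-Hermitian
   matrix Z. *)
Section LieAlgebra.
Variables (R : realType) (n : nat).

Definition lie (X Y : 'M[R[i]]_n) : 'M[R[i]]_n := X *m Y - Y *m X.

Definition su_index (ij : 'I_n * 'I_n) : bool :=
  ~~ ((ij.1 == ij.2) && (ij.1.+1 == n)).

Definition su_basis (ij : 'I_n * 'I_n) : 'M[R[i]]_n :=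
  let: (i, j) := ij in
  if (i < j)%N then delta_mx i j - delta_mx j i
  else if (j < i)%N then 'i%C *: (delta_mx i j + delta_mx j i)
  else 'i%C *: (delta_mx i i - \sum_(k < n | k.+1 == n) delta_mx k k).

Definition su_coord (ij : 'I_n * 'I_n) (Z : 'M[R[i]]_n) : R :=
  if (ij.1 < ij.2)%N then complex.Re (Z ij.1 ij.2)
  else complex.Im (Z ij.1 ij.2).

(* B(X, Y), the trace of ad X \o ad Y on su(n) *)
Definition killing (X Y : 'M[R[i]]_n) : R :=
  \sum_(ij | su_index ij) su_coord ij (lie X (lie Y (su_basis ij))).

Definition Qform (X Y : 'M[R[i]]_n) : R := - killing X Y.

Definition max_torus (t : 'M[R[i]]_n) : Prop :=
  [/\ is_diag_mx t, t *m (map_mx (@conjc R) t)^T = 1%:M & \det t = 1].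

Definition Ad (t X : 'M[R[i]]_n) : 'M[R[i]]_n := t *m X *m invmx t.

Definition tpart (Z : 'M[R[i]]_n) : 'M[R[i]]_n := diag_mx (\row_i Z i i).

End LieAlgebra.

Notation off_diag n := {ij : 'I_n * 'I_n | ij.1 != ij.2}.

(* n(n-1), the dimension of p *)
Definition pdim (n : nat) : nat := #|{: off_diag n}|.

(* Elements of p = T_o F(n) are row vectors of coordinates in the off-diagonal
   part of su_basis, and a bilinear form on p is its Gram matrix in this
   basis. *)
Section FlagManifold.
Variables (R : realType) (n : nat).
Local Notation N := (pdim n).

Definition pidx (a : 'I_N) : 'I_n * 'I_n := val (enum_val a : off_diag n).

Definition pvec (v : 'rV[R]_N) : 'M[R[i]]_n :=
  \sum_a (v 0 a)%:C *: su_basis R (pidx a).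

(* on su(n), the Q-orthogonal projection onto p, in coordinates *)
Definition pcoord (Z : 'M[R[i]]_n) : 'rV[R]_N := \row_a su_coord (pidx a) Z.

Definition pbasis (a : 'I_N) : 'rV[R]_N := delta_mx 0 a.

Definition form (S : 'M[R]_N) (v w : 'rV[R]_N) : R := (v *m S *m w^T) 0 0.

(* A G-invariant symmetric 2-tensor on F(n) is an Ad(T)-invariant symmetric
   bilinear form on p. *)
Definition invariant_tensor (S : 'M[R]_N) : Prop :=
  S^T = S /\
  forall t, max_torus t -> forall v w,
    form S (pcoord (Ad t (pvec v))) (pcoord (Ad t (pvec w))) = form S v w.

Definition invariant_metric (g : 'M[R]_N) : Prop :=
  invariant_tensor g /\ forall v, v != 0 -> 0 < form g v v.

Definition block (a : 'I_N) : 'I_n * 'I_n :=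
  let: (i, j) := pidx a in if (i < j)%N then (i, j) else (j, i).

(* \sum_(i < j) x_ij Q|p_ij ; only the values x (i, j) with i < j matter *)
Definition diag_metric (x : 'I_n * 'I_n -> R) : 'M[R]_N :=
  \matrix_(a, b) if block a == block b
                 then x (block a) * Qform (su_basis R (pidx a))
                                          (su_basis R (pidx b))
                 else 0.

Definition standard_metric : 'M[R]_N := diag_metric (fun=> 1).

(* Curvature of a G-invariant metric g at the origin o (Nomizu).  Under
   p = T_o F(n), the Levi-Civita connection is Lambda(X)Y = [X,Y]_p / 2 + U(X,Y)
   with 2 g(U(X,Y),Z) = g([Z,X]_p,Y) + g(X,[Z,Y]_p), and
   R(X,Y)Z = Lambda(X)Lambda(Y)Z - Lambda(Y)Lambda(X)Z - Lambda([X,Y]_p)Z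
             - [[X,Y]_t,Z]. *)

Definition pbracket (v w : 'rV[R]_N) : 'rV[R]_N := pcoord (lie (pvec v) (pvec w)).

Definition Utensor (g : 'M[R]_N) (v w : 'rV[R]_N) : 'rV[R]_N :=
  2^-1 *: ((\row_c (form g (pbracket (pbasis c) v) w
                    + form g v (pbracket (pbasis c) w))) *m invmx g).

Definition nomizu (g : 'M[R]_N) (v w : 'rV[R]_N) : 'rV[R]_N :=
  2^-1 *: pbracket v w + Utensor g v w.

Definition curvature (g : 'M[R]_N) (v w z : 'rV[R]_N) : 'rV[R]_N :=
  nomizu g v (nomizu g w z) - nomizu g w (nomizu g v z)
  - nomizu g (pbracket v w) z
  - pcoord (lie (tpart (lie (pvec v) (pvec w))) (pvec z)).

(* Rc(Y,Z), the trace of X |-> R(X,Y)Z *)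
Definition ricci (g : 'M[R]_N) (w z : 'rV[R]_N) : R :=
  \sum_a curvature g (pbasis a) w z 0 a.

Definition gtrace (g S : 'M[R]_N) : R := \tr (invmx g *m S).

Definition scal (g : 'M[R]_N) : R :=
  gtrace g (\matrix_(a, b) ricci g (pbasis a) (pbasis b)).

Definition einstein (g : 'M[R]_N) : Prop :=
  exists rho : R, forall v w, ricci g v w = rho * form g v w.

(* (nabla_X S)(Y,Z) for an invariant 2-tensor S *)
Definition nabla (g S : 'M[R]_N) (v w z : 'rV[R]_N) : R :=
  - form S (nomizu g v w) z - form S w (nomizu g v z).

Definition divergence (g S : 'M[R]_N) (z : 'rV[R]_N) : R :=
  gtrace g (\matrix_(a, b) nabla g S (pbasis a) (pbasis b) z).

(* TT_g^G *)
Definition TT (g S : 'M[R]_N) : Prop :=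
  [/\ invariant_tensor S, gtrace g S = 0 & forall z, divergence g S z = 0].

(* V0 > 0 stands for the total volume of (F(n), Q), i.e. of the standard
   metric. *)
Definition volume (V0 : R) (g : 'M[R]_N) : R :=
  V0 * Num.sqrt (\det g / \det standard_metric).

Definition unit_rescale (V0 : R) (g : 'M[R]_N) : 'M[R]_N :=
  ((volume V0 g) `^ (- (2 / N%:R))) *: g.

(* Sc''_g(S1,S2) for an Einstein metric g in M_1^G.  As g is a critical point
   of Sc on M_1^G, its Hessian there may be computed in any chart; we use
   S |-> unit_rescale (g + S), defined for small S in T_g M_1^G = TT_g^G, whose
   differential at 0 is the identity. *)
Definition scal_hessian (V0 : R) (g S1 S2 : 'M[R]_N) : R :=
  derive1 (fun s : R =>
    derive1 (fun t : R => scal (unit_rescale V0 (g + s *: S1 + t *: S2))) 0) 0.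

Definition G_unstable (V0 : R) (g : 'M[R]_N) : Prop :=
  let g1 := unit_rescale V0 g in
  exists2 S, TT g1 S & 0 < scal_hessian V0 g1 S S.

Definition G_nondegenerate (V0 : R) (g : 'M[R]_N) : Prop :=
  let g1 := unit_rescale V0 g in
  forall S, TT g1 S ->
    (forall S', TT g1 S' -> scal_hessian V0 g1 S S' = 0) -> S = 0.

Definition has_coindex (V0 : R) (g : 'M[R]_N) (k : nat) : Prop :=
  let g1 := unit_rescale V0 g in
  let positive_on (V : {vspace 'M[R]_N}) :=
    (forall S, S \in V -> TT g1 S) /\
    (forall S, S \in V -> S != 0 -> 0 < scal_hessian V0 g1 S S) in
  (exists2 V, positive_on V & \dim V = k) /\
  (forall V, positive_on V -> (\dim V <= k)%N).

End FlagManifold.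

(* Main.v *)
(* Conjugation by diagonal matrices
   with two nontrivial entries z, z^-1 (z = -1 or z = i) shows that an invariant
   symmetric 2-tensor is a weight y_ij on each p_ij, i.e. a function on the edges
   of the complete graph K_5; it is always divergence free.  The basis of p has
   structure constants C_abc in {0, 1, -1} which are totally antisymmetric, and
   Koszul's formula gives, for a metric x,
     Sc = 10 \sum_a 1/x_a - 1/4 \sum_abc C_abc^2 x_c / (x_a x_b).
   Rescaling to unit volume multiplies this by a multiple of
   (\prod_a x_a)^(1/N), so Sc becomes a combination of monomials of degree 0; the
   Hessian of exp (m . ln x) is immediate and Sc'' is, up to a positive factor,
     q(y) = 2 \sum_i s_i^2 - \sum_a y_a^2,  s_i = \sum_(j != i) y_ij.
   If all s_i vanish then q(y) = - \sum_a y_a^2.  On the 4-dimensional space of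
   the weights y_ij = u_i + u_j with \sum_i u_i = 0 one has s = 3 u, and q pairs y
   with u to 4 \sum_i u_i s_i(y).  Hence q is positive there, non-degenerate, and
   s is injective into R^4 on every positive subspace. *)

From HB Require Import structures.
From mathcomp Require Import all_boot all_order all_algebra.
From mathcomp Require Import all_classical all_reals all_analysis.
From mathcomp Require Import complex ring lra zify.
Require Import Defs.

Set Implicit Arguments.
Unset Strict Implicit.
Unset Printing Implicit Defensive.

Import Order.TTheory GRing.Theory Num.Theory.
Import numFieldNormedType.Exports.
Local Open Scope ring_scope.
Local Open Scope complex_scope.

Lemma sum_delta (R : realType) (I : finType) (f : I -> R) i :
  \sum_j (j == i)%:R * f j = f i.
Proof.
rewrite (bigD1 i) //= big1 => [|j nij]; first by rewrite eqxx mul1r addr0.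
by rewrite (negPf nij) mul0r.
Qed.

(** * Structure constants *)

Section Coordinates.
Variables (R : realType) (n : nat).
Local Notation N := (pdim n).
Implicit Types (a b c : 'I_N) (p : 'I_n * 'I_n) (v w : 'rV[R]_N).
Implicit Types X Y Z : 'M[R[i]]_n.

Lemma pidx_neq a : (pidx a).1 != (pidx a).2.
Proof. exact: (valP (enum_val a : off_diag n)). Qed.

Lemma pidx_inj : injective (@pidx n).
Proof. by move=> a b /val_inj /enum_val_inj. Qed.

Lemma pidx_surj p : p.1 != p.2 -> exists a, pidx a = p.
Proof.
move=> hp; exists (enum_rank (Sub p hp : off_diag n)).
by rewrite /pidx enum_rankK.
Qed.

Lemma sum_pidx (V : nmodType) (F : 'I_n * 'I_n -> V) :
  \sum_a F (pidx a) = \sum_(p | p.1 != p.2) F p.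
Proof.
rewrite (big_sub [pred p : 'I_n * 'I_n | p.1 != p.2] F).
by rewrite (big_enum_val (fun u : off_diag n => F (val u))).
Qed.

Lemma lieE X Y i j : lie X Y i j = \sum_k (X i k * Y k j - Y i k * X k j).
Proof. by rewrite !mxE -sumrB. Qed.

Lemma lie_suml (I : finType) (z : I -> R[i]) (X : I -> 'M[R[i]]_n) Y :
  lie (\sum_k z k *: X k) Y = \sum_k z k *: lie (X k) Y.
Proof.
rewrite /lie mulmx_suml mulmx_sumr -sumrB; apply: eq_bigr => k _.
by rewrite -scalemxAl -scalemxAr scalerBr.
Qed.

Lemma lie_sumr (I : finType) (z : I -> R[i]) (X : I -> 'M[R[i]]_n) Y :
  lie Y (\sum_k z k *: X k) = \sum_k z k *: lie Y (X k).
Proof.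
rewrite /lie mulmx_suml mulmx_sumr -sumrB; apply: eq_bigr => k _.
by rewrite -scalemxAl -scalemxAr scalerBr.
Qed.

Lemma tpart_sum (I : finType) (z : I -> R[i]) (X : I -> 'M[R[i]]_n) :
  tpart (\sum_k z k *: X k) = \sum_k z k *: tpart (X k).
Proof.
apply/matrixP => i j; rewrite /tpart summxE !mxE summxE -sumrMnl.
by apply: eq_bigr => k _; rewrite !mxE mulrnAr.
Qed.

Lemma su_coord_sum p (I : finType) (x : I -> R) (X : I -> 'M[R[i]]_n) :
  su_coord p (\sum_k (x k)%:C *: X k) = \sum_k x k * su_coord p (X k).
Proof.
rewrite /su_coord summxE; case: ifP => _.
  rewrite (raddf_sum (@complex.Re R)); apply: eq_bigr => k _.
  by rewrite mxE; case: (X k _ _) => ? ? /=; rewrite mul0r subr0.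
rewrite (raddf_sum (@complex.Im R)); apply: eq_bigr => k _.
by rewrite mxE; case: (X k _ _) => ? ? /=; rewrite mul0r addr0.
Qed.

Lemma pvec_pbasis a : pvec (pbasis R a) = su_basis R (pidx a).
Proof.
rewrite /pvec (bigD1 a) //= big1 ?addr0 => [|b nba].
  by rewrite mxE !eqxx scale1r.
by rewrite mxE (negPf nba) andbF scale0r.
Qed.

Definition structure_const a b c : R := pbracket (pbasis R a) (pbasis R b) 0 c.

Lemma pbracketE v w c :
  pbracket v w 0 c = \sum_a \sum_b v 0 a * w 0 b * structure_const a b c.
Proof.
rewrite mxE lie_suml su_coord_sum; apply: eq_bigr => a _.
rewrite lie_sumr su_coord_sum mulr_sumr; apply: eq_bigr => b _.
by rewrite mulrA /structure_const mxE !pvec_pbasis.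
Qed.

(** Trilinear expansion of the isotropy term of [curvature], so that its trace can be computed from
    constants on basis vectors. *)
Lemma torus_bracketE v w z c :
  pcoord (lie (tpart (lie (pvec v) (pvec w))) (pvec z)) 0 c =
  \sum_a \sum_b \sum_d v 0 a * w 0 b * z 0 d *
    su_coord (pidx c) (lie (tpart (lie (su_basis R (pidx a))
      (su_basis R (pidx b)))) (su_basis R (pidx d))).
Proof.
rewrite mxE lie_suml (tpart_sum (fun a => (v 0 a)%:C)).
rewrite lie_suml su_coord_sum; apply: eq_bigr => a _.
rewrite [lie (su_basis _ _) _]lie_sumr (tpart_sum (fun b => (w 0 b)%:C)).
rewrite lie_suml su_coord_sum mulr_sumr.
apply: eq_bigr => b _; rewrite lie_sumr su_coord_sum !mulr_sumr.
by apply: eq_bigr => d _; rewrite !mulrA.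
Qed.

End Coordinates.

(* Matrices over Z[i] indexed by natural numbers, on which the structure
   constants of su(n) can be evaluated. *)
Definition gint : Type := int * int.

Section GaussianMatrices.
Variable n : nat.
Implicit Types (p : nat * nat) (X Y : nat -> nat -> gint).

Definition gadd (x y : gint) : gint := (x.1 + y.1, x.2 + y.2).
Definition gopp (x : gint) : gint := (- x.1, - x.2).
Definition gmul (x y : gint) : gint :=
  (x.1 * y.1 - x.2 * y.2, x.1 * y.2 + x.2 * y.1).

Definition int_basis p : nat -> nat -> gint :=
  let: (i, j) := p in fun k l =>
  if (i < j)%N then ((((k == i) && (l == j))%:Z - ((k == j) && (l == i))%:Z), 0)
  else if (j < i)%N then
    (0, ((k == i) && (l == j))%:Z + ((k == j) && (l == i))%:Z)
  else (0, ((k == i) && (l == i))%:Z - ((k == n.-1) && (l == n.-1))%:Z).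

(** Folded over an explicit list, as is [int_sum], so that closed instances evaluate by
    computation. *)
Definition int_lie X Y k l : gint :=
  foldr (fun m s => gadd (gadd (gmul (X k m) (Y m l))
                               (gopp (gmul (Y k m) (X m l)))) s)
        (0, 0) (iota 0 n).

Definition int_tpart X k l : gint := if k == l then X k k else (0, 0).

Definition int_coord p X : int :=
  if (p.1 < p.2)%N then (X p.1 p.2).1 else (X p.1 p.2).2.

Definition int_const p q r : int :=
  int_coord r (int_lie (int_basis p) (int_basis q)).

Definition pairs : seq (nat * nat) := [seq (i, j) | i <- iota 0 n, j <- iota 0 n].

Definition off_diag_pairs : seq (nat * nat) := [seq p <- pairs | p.1 != p.2].

Definition int_sum (s : seq (nat * nat)) (F : nat * nat -> int) : int :=
  foldr (fun p s => F p + s) 0 s.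

Definition int_killing p q : int :=
  int_sum [seq r <- pairs | ~~ ((r.1 == r.2) && (r.1.+1 == n))] (fun r =>
    int_coord r (int_lie (int_basis p) (int_lie (int_basis q) (int_basis r)))).

(** Diagonal entry at [r] of the map X |-> [[X, e_p]_t, e_q]; its sum over [r] is the trace that
    enters the Ricci tensor. *)
Definition int_torus_const p q r : int :=
  int_coord r (int_lie (int_tpart (int_lie (int_basis r) (int_basis p)))
                       (int_basis q)).

End GaussianMatrices.

(** * Transfer from Gaussian integer matrices to complex matrices *)

Section GaussianReflection.
Variables (R : realType) (n : nat).

Definition gval (x : gint) : R[i] := x.1%:~R +i* x.2%:~R.

Definition represents (X : 'M[R[i]]_n) (Y : nat -> nat -> gint) :=
  forall i j, X i j = gval (Y i j).

Lemma gvalD x y : gval (gadd x y) = gval x + gval y.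
Proof. by rewrite /gval /gadd !rmorphD. Qed.

Lemma gvalN x : gval (gopp x) = - gval x.
Proof. by rewrite /gval /gopp !rmorphN. Qed.

Lemma gvalM x y : gval (gmul x y) = gval x * gval y.
Proof. by rewrite /gval /gmul !(rmorphD, rmorphN, rmorphM). Qed.

Lemma represents_basis (p : 'I_n * 'I_n) :
  represents (su_basis R p) (int_basis n (val p.1, val p.2)).
Proof.
case: p => i j k l /=; rewrite /su_basis /gval; case: ifP => _.
  rewrite !mxE -!val_eqE rmorphB /=.
  by do 2!case: (_ && _); apply/eqP; rewrite eq_complex /= ?(oppr0, addr0, eqxx).
case: ifP => _.
  rewrite !mxE -!val_eqE rmorphD /=.
  by do 2!case: (_ && _); apply/eqP; rewrite eq_complex /=
    ?(mul0r, mulr0, mul1r, addr0, add0r, subr0, oppr0, eqxx).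
(* The condition [m.+1 == n] selects the single index n-1, which exists because 'I_n is
   inhabited. *)
have -> : 'i%C *: (delta_mx i i - \sum_(m < n | m.+1 == n) delta_mx m m) =
    'i%C *: (delta_mx i i - \matrix_(k, l) ((val k == n.-1) && (val l == n.-1))%:R)
    :> 'M[R[i]]_n.
  have n_gt0 : (0 < n)%N by case: n k => [[]|].
  have ltn : (n.-1 < n)%N by rewrite prednK.
  congr (_ *: (_ - _)); rewrite (big_pred1 (Ordinal ltn)) => [|m].
    by apply/matrixP => u w; rewrite !mxE.
  by rewrite /= -val_eqE /= -(eqSS m n.-1) prednK.
rewrite !mxE -!val_eqE rmorphB /=.
by do 2!case: (_ && _); apply/eqP; rewrite eq_complex /=
  ?(mul0r, mulr0, mul1r, addr0, add0r, subr0, oppr0, eqxx).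
Qed.

Lemma represents_lie X Y X' Y' :
  represents X X' -> represents Y Y' -> represents (lie X Y) (int_lie n X' Y').
Proof.
move=> hX hY i j; rewrite lieE /int_lie.
under eq_bigr => k _ do rewrite !hX !hY.
pose F m := gadd (gmul (X' i m) (Y' m j)) (gopp (gmul (Y' i m) (X' m j))).
rewrite -(big_mkord xpredT (fun k => gval (X' i k) * gval (Y' k j) -
            gval (Y' i k) * gval (X' k j))).
rewrite /index_iota subn0; elim: (iota 0 n) => [|m s IHs].
  by rewrite big_nil.
by rewrite big_cons IHs /= !gvalD gvalN !gvalM.
Qed.

Lemma represents_tpart X X' :
  represents X X' -> represents (tpart X) (int_tpart X').
Proof.
move=> hX i j; rewrite /tpart !mxE hX /int_tpart -val_eqE.
by case: (_ == _).
Qed.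

Lemma su_coord_represents (p : 'I_n * 'I_n) X X' :
  represents X X' -> su_coord p X = (int_coord (val p.1, val p.2) X')%:~R.
Proof. by move=> hX; rewrite /su_coord /int_coord hX; case: ifP. Qed.

Definition npair (p : 'I_n * 'I_n) : nat * nat := (val p.1, val p.2).

Lemma structure_constE (a b c : 'I_(pdim n)) :
  structure_const R a b c =
  (int_const n (npair (pidx a)) (npair (pidx b)) (npair (pidx c)))%:~R.
Proof.
rewrite /structure_const mxE !pvec_pbasis; apply: su_coord_represents.
by apply: represents_lie; apply: represents_basis.
Qed.

Lemma npair_pidx (a : 'I_(pdim n)) : npair (pidx a) \in off_diag_pairs n.
Proof.
rewrite mem_filter (pidx_neq a) /=; apply/allpairsP.
by exists (npair (pidx a)); rewrite !mem_iota /= !add0n !ltn_ord.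
Qed.

Lemma sum_pairs_int (P : pred (nat * nat)) (F : nat * nat -> int) :
  \sum_(p : 'I_n * 'I_n | P (npair p)) (F (npair p))%:~R =
  (int_sum [seq p <- pairs n | P p] F)%:~R :> R.
Proof.
transitivity (\sum_(p <- pairs n | P p) (F p)%:~R : R); last first.
  rewrite -big_filter /int_sum; elim: (seq.filter _ _) => [|p s IHs].
    by rewrite big_nil.
  by rewrite big_cons IHs /= rmorphD.
rewrite big_mkcond [RHS]big_mkcond big_allpairs /=.
pose G (i j : nat) : R := if P (i, j) then (F (i, j))%:~R else 0.
transitivity (\sum_(i < n) \sum_(j < n) G i j).
  by rewrite pair_bigA; apply: eq_bigr => -[i j] _.
rewrite -(big_mkord xpredT (fun i => \sum_(j < n) G i j)) /index_iota subn0.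
by apply: eq_bigr => i _; rewrite -(big_mkord xpredT (G i)) /index_iota subn0.
Qed.

Lemma sum_pidx_int (F : nat * nat -> int) :
  \sum_(a < pdim n) (F (npair (pidx a)))%:~R =
  (int_sum (off_diag_pairs n) F)%:~R :> R.
Proof.
by rewrite (sum_pidx (fun p => (F (npair p))%:~R)) -sum_pairs_int; apply: eq_bigl.
Qed.

Lemma QformE (a b : 'I_(pdim n)) :
  Qform (su_basis R (pidx a)) (su_basis R (pidx b)) =
  - (int_killing n (npair (pidx a)) (npair (pidx b)))%:~R.
Proof.
rewrite /Qform /killing /int_killing -sum_pairs_int; congr (- _).
apply: eq_bigr => p _; apply: su_coord_represents.
by do 2!(apply: represents_lie; first exact: represents_basis);
   apply: represents_basis.
Qed.

Lemma torus_constE (a b c : 'I_(pdim n)) :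
  su_coord (pidx c) (lie (tpart (lie (su_basis R (pidx c)) (su_basis R (pidx a))))
                         (su_basis R (pidx b))) =
  (int_torus_const n (npair (pidx a)) (npair (pidx b)) (npair (pidx c)))%:~R.
Proof.
apply: su_coord_represents.
apply: represents_lie (represents_basis _); apply: represents_tpart.
by apply: represents_lie; apply: represents_basis.
Qed.

End GaussianReflection.

(** For off-diagonal pairs read as unoriented edges: sharing exactly one vertex. Equal or reversed
    pairs give the count 2 and are not adjacent. *)
Definition adjacent (T : eqType) (p q : T * T) : bool :=
  ((p.1 == q.1) + (p.1 == q.2) + (p.2 == q.1) + (p.2 == q.2) == 1)%N.

(** * Structure constants for n = 5, verified by exhaustive evaluation *)

Definition off_diag5 : seq (nat * nat) := Eval vm_compute in off_diag_pairs 5.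

(** The basis of p is Q-orthogonal with all norms equal, so the Ad-invariance of Q makes the
    constants totally antisymmetric. *)
Lemma int_const_alternating :
  all (fun p => all (fun q => all (fun r =>
    (int_const 5 q p r == - int_const 5 p q r) &&
    (int_const 5 q r p == int_const 5 p q r)) off_diag5) off_diag5) off_diag5.
Proof. by vm_compute. Qed.

(** Two edges with one common vertex bracket to plus or minus one basis vector of the third side of
    their triangle; disjoint edges commute, and the bracket within one edge lies in t. *)
Lemma int_const_sum_sq :
  all (fun p => all (fun q =>
    int_sum off_diag5 (fun r => int_const 5 p q r * int_const 5 p q r) ==
    (adjacent p q)%:Z) off_diag5) off_diag5.
Proof. by vm_compute. Qed.

(** An edge of K_5 has 3 neighbours at each of its 2 ends, and every edge carries 2 basis
    vectors. *)
Lemma int_sum_adjacent :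
  all (fun p => int_sum off_diag5 (fun q => (adjacent p q)%:Z) == 12%:Z) off_diag5.
Proof. by vm_compute. Qed.

(** Only the reversal of [p] brackets with e_p to a nonzero diagonal element. That element is, up to
    sign, 2i (E_ii - E_jj), and it turns p_ij with speed 4. *)
Lemma int_torus_const_sum :
  all (fun p => all (fun q =>
    int_sum off_diag5 (int_torus_const 5 p q) == - (4%:Z * (p == q)%:Z))
  off_diag5) off_diag5.
Proof. by vm_compute. Qed.

(** On su(5) the Killing form is 10 tr(XY), and the square of an off-diagonal basis vector has trace
    -2. *)
Lemma int_killing_block :
  all (fun p => (int_killing 5 p p == - 20%:Z) &&
                (int_killing 5 p (p.2, p.1) == 0)) off_diag5.
Proof. by vm_compute. Qed.

Section StructureConstants.
Variable R : realType.
Local Notation N := (pdim 5).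
Local Notation C := (structure_const R).
Implicit Types a b c d : 'I_N.

Lemma structure_const_asym a b c : C b a c = - C a b c.
Proof.
rewrite !structure_constE -rmorphN; congr _%:~R; apply/eqP.
have /allP/(_ _ (npair_pidx a))/allP/(_ _ (npair_pidx b)) := int_const_alternating.
by move=> /allP/(_ _ (npair_pidx c))/andP[].
Qed.

Lemma structure_const_cyc a b c : C b c a = C a b c.
Proof.
rewrite !structure_constE; congr _%:~R; apply/eqP.
have /allP/(_ _ (npair_pidx a))/allP/(_ _ (npair_pidx b)) := int_const_alternating.
by move=> /allP/(_ _ (npair_pidx c))/andP[].
Qed.

Lemma structure_const0 a b : C a a b = 0.
Proof. by have := structure_const_asym a a b; lra. Qed.

Lemma structure_const_sum_sq a b :
  \sum_c C a b c ^+ 2 = (adjacent (pidx a) (pidx b))%:R.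
Proof.
under eq_bigr => c _ do rewrite structure_constE expr2 -rmorphM.
rewrite (@sum_pidx_int R 5 (fun r => int_const 5 (npair (pidx a)) (npair (pidx b)) r
                          * int_const 5 (npair (pidx a)) (npair (pidx b)) r)).
have /allP/(_ _ (npair_pidx a))/allP/(_ _ (npair_pidx b))/eqP -> := int_const_sum_sq.
by [].
Qed.

Lemma sum_adjacent a : \sum_b (adjacent (pidx a) (pidx b))%:R = 12 :> R.
Proof.
rewrite (@sum_pidx_int R 5 (fun q => (adjacent (npair (pidx a)) q)%:Z)).
by have /allP/(_ _ (npair_pidx a))/eqP -> := int_sum_adjacent.
Qed.

(* [e_a, e_b]_p is 0 or plus or minus a basis vector. *)
Lemma structure_const_mul0 a b c d : c != d -> C a b c * C a b d = 0.
Proof.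
move=> ncd; have : C a b c ^+ 2 + C a b d ^+ 2 <= 1.
  have <- : (1%:R : R) = 1 by [].
  apply: (@le_trans _ _ (adjacent (pidx a) (pidx b))%:R); last by case: adjacent.
  rewrite -structure_const_sum_sq (bigD1 c) // (bigD1 d) 1?eq_sym //= addrA.
  by rewrite lerDl sumr_ge0 // => k _; rewrite sqr_ge0.
(* The constants are integers: two nonzero ones would have squares adding up to at least 2. *)
rewrite !structure_constE -!rmorphXn -rmorphD -rmorphM lerz1 => h.
apply/eqP; rewrite intr_eq0 mulf_eq0.
move: h; set x := int_const _ _ _ _; set y := int_const _ _ _ _.
case: (eqVneq x 0) => //= nx; case: (eqVneq y 0) => //= ny.
have : 1 <= x ^+ 2 by rewrite -gtz0_ge1 exprn_even_gt0.
have : 1 <= y ^+ 2 by rewrite -gtz0_ge1 exprn_even_gt0.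
lra.
Qed.

Lemma torus_const_sum b d :
  \sum_a su_coord (pidx a) (lie (tpart (lie (su_basis R (pidx a))
    (su_basis R (pidx b)))) (su_basis R (pidx d))) = - (4 * (b == d)%:R).
Proof.
under eq_bigr => c _ do rewrite torus_constE.
rewrite (@sum_pidx_int R 5 (int_torus_const 5 (npair (pidx b)) (npair (pidx d)))).
have /allP/(_ _ (npair_pidx b))/allP/(_ _ (npair_pidx d))/eqP -> := int_torus_const_sum.
rewrite rmorphN rmorphM /=; congr (- (_ * _%:R)).
by rewrite -(inj_eq (@pidx_inj 5)).
Qed.

Lemma standard_metricE : standard_metric R 5 = 20%:M.
Proof.
apply/matrixP => a b; rewrite !mxE mul1r QformE.
have := allP int_killing_block _ (npair_pidx a).
case: (eqVneq a b) => [<-|nab] /andP[/eqP q1 /eqP q2].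
  by rewrite eqxx q1 rmorphN opprK mulr1n.
rewrite mulr0n; case: eqP => // eq_block.
(* Distinct indices with the same block are a pair and its reversal, the real and imaginary parts of
   one p_ij, which are Q-orthogonal. *)
suff -> : npair (pidx b) = ((npair (pidx a)).2, (npair (pidx a)).1).
  by rewrite q2 oppr0.
move: eq_block nab; rewrite -(inj_eq (@pidx_inj 5)) /block /npair.
case: (pidx a) (pidx b) => i j [k l] /=.
by case: ifP; case: ifP => _ _ [-> ->] //; rewrite eqxx.
Qed.

End StructureConstants.

(** * Curvature of diagonal metrics *)

Section DiagonalMetric.
Variables (R : realType).
Local Notation N := (pdim 5).
Local Notation C := (structure_const R).
Implicit Types (a b c d e : 'I_N) (v w z : 'rV[R]_N) (x : 'I_N -> R).

Definition diag_form x : 'M[R]_N := diag_mx (\row_a x a).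

Lemma diag_formE x a b : diag_form x a b = x a *+ (a == b).
Proof. by rewrite !mxE. Qed.

Lemma row_mul_diag_form x v a : (v *m diag_form x) 0 a = v 0 a * x a.
Proof. by rewrite /diag_form mul_mx_diag !mxE. Qed.

Lemma form_diag_form x v w :
  form (diag_form x) v w = \sum_a x a * v 0 a * w 0 a.
Proof.
rewrite /form mxE; apply: eq_bigr => a _.
by rewrite row_mul_diag_form mxE [v 0 a * _]mulrC.
Qed.

Lemma diag_form_inv x : (forall a, x a != 0) ->
  invmx (diag_form x) = diag_form (fun a => (x a)^-1).
Proof.
move=> x_neq0.
have xx1 : diag_form x *m diag_form (fun a => (x a)^-1) = 1%:M.
  apply/matrixP => a b; rewrite mul_diag_mx !mxE.
  by case: eqP => _; rewrite ?mulr0 //= mulfV.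
have [x_unit _] := mulmx1_unit xx1.
by rewrite -[RHS](mulKmx x_unit) xx1 mulmx1.
Qed.

Lemma gtrace_diag_form x S : (forall a, x a != 0) ->
  gtrace (diag_form x) S = \sum_a (x a)^-1 * S a a.
Proof.
move=> x_neq0; rewrite /gtrace diag_form_inv // /mxtrace.
by apply: eq_bigr => a _; rewrite mul_diag_mx !mxE.
Qed.

Lemma sum_pbasis (F : 'I_N -> R) a : \sum_b pbasis R a 0 b * F b = F a.
Proof.
rewrite (bigD1 a) //= big1 => [|b nba]; first by rewrite mxE !eqxx mul1r addr0.
by rewrite mxE (negPf nba) andbF mul0r.
Qed.

Lemma pbracket_pbasis a w c : pbracket (pbasis R a) w 0 c = \sum_b w 0 b * C a b c.
Proof.
rewrite pbracketE; under eq_bigr => b _ do under eq_bigr => d _ do rewrite -mulrA.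
by under eq_bigr => b _ do rewrite -mulr_sumr; rewrite sum_pbasis.
Qed.

(** Koszul's formula for the e_c-coordinate of Lambda(e_a) e_b; total antisymmetry of [C] brings the
    terms of [Utensor] to this form. *)
Definition levi_civita x a b c : R := C a b c * (1 + (x b - x a) / x c) / 2.

Lemma nomizuE x v w c : (forall a, x a != 0) ->
  nomizu (diag_form x) v w 0 c =
  \sum_a \sum_b v 0 a * w 0 b * levi_civita x a b c.
Proof.
move=> x_neq0; rewrite /nomizu /Utensor diag_form_inv // [LHS]mxE.
rewrite [X in X + _]mxE [X in _ + X]mxE row_mul_diag_form [X in X / _]mxE.
rewrite !form_diag_form.
have -> : \sum_b x b * pbracket (pbasis R c) v 0 b * w 0 b =
    \sum_a \sum_b v 0 a * w 0 b * (C a b c * x b).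
  rewrite exchange_big; apply: eq_bigr => b _.
  rewrite pbracket_pbasis mulr_sumr mulr_suml; apply: eq_bigr => a _.
  by rewrite -(structure_const_cyc R a b c) -(structure_const_cyc R b c a); ring.
have -> : \sum_a x a * v 0 a * pbracket (pbasis R c) w 0 a =
    \sum_a \sum_b v 0 a * w 0 b * (- C a b c * x a).
  apply: eq_bigr => a _; rewrite pbracket_pbasis mulr_sumr.
  apply: eq_bigr => b _.
  by rewrite -structure_const_asym -(structure_const_cyc R c b a); ring.
rewrite pbracketE -big_split mulr_suml !mulr_sumr -big_split.
apply: eq_bigr => a _ /=.
rewrite -big_split mulr_suml !mulr_sumr -big_split; apply: eq_bigr => b _ /=.
by rewrite /levi_civita; field; rewrite x_neq0.
Qed.

Lemma nomizu_pbasis x a w c : (forall a, x a != 0) ->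
  nomizu (diag_form x) (pbasis R a) w 0 c = \sum_b w 0 b * levi_civita x a b c.
Proof.
move=> x_neq0; rewrite nomizuE //.
under eq_bigr => b _ do under eq_bigr => d _ do rewrite -mulrA.
by under eq_bigr => b _ do rewrite -mulr_sumr; rewrite sum_pbasis.
Qed.

Lemma levi_civita_diag x a b : levi_civita x a b a = 0.
Proof. by rewrite /levi_civita structure_const_cyc structure_const0 !mul0r. Qed.

Lemma levi_civita_cst (r : R) a b c : levi_civita (fun=> r) a b c = C a b c / 2.
Proof. by rewrite /levi_civita subrr mul0r addr0 mulr1. Qed.

(** Matrix of the Ricci tensor in the basis of p. The diagonal term 4 is minus the trace of the
    isotropy map in [torus_const_sum]. *)
Definition ricci_coef x b d : R :=
  4 * (b == d)%:R - \sum_a \sum_e (levi_civita x a d e * levi_civita x b e a +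
                                   C a b e * levi_civita x e d a).

Lemma ricciE x w z : (forall a, x a != 0) ->
  ricci (diag_form x) w z = \sum_b \sum_d w 0 b * z 0 d * ricci_coef x b d.
Proof.
move=> x_neq0; pose T a b d := su_coord (pidx a) (lie (tpart
  (lie (su_basis R (pidx a)) (su_basis R (pidx b)))) (su_basis R (pidx d))).
transitivity (\sum_a \sum_b \sum_d w 0 b * z 0 d * (- T a b d -
    \sum_e (levi_civita x a d e * levi_civita x b e a + C a b e * levi_civita x e d a))).
  apply: eq_bigr => a _.
  have rowB3 (p q r s : 'rV[R]_N) :
      (p - q - r - s) 0 a = p 0 a - q 0 a - r 0 a - s 0 a by rewrite !mxE.
  rewrite /curvature rowB3.
  (* The 0 is the trace of X |-> Lambda(X) Lambda(w) z: by [levi_civita_diag], Lambda(e_a) has no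
     e_a-component in its values. *)
  transitivity (0
    - \sum_b \sum_d w 0 b * z 0 d * (\sum_e levi_civita x a d e * levi_civita x b e a)
    - \sum_b \sum_d w 0 b * z 0 d * (\sum_e C a b e * levi_civita x e d a)
    - \sum_b \sum_d w 0 b * z 0 d * T a b d).
  congr (_ - _ - _ - _).
  - rewrite [LHS]nomizu_pbasis // big1 // => e _.
    by rewrite levi_civita_diag mulr0.
  - rewrite [LHS]nomizuE //.
    apply: eq_bigr => b _; under [RHS]eq_bigr => d _ do rewrite mulr_sumr.
    rewrite exchange_big; apply: eq_bigr => e _ /=.
    rewrite [X in _ * X * _]nomizu_pbasis // mulr_sumr mulr_suml.
    by apply: eq_bigr => d _; ring.
  - rewrite [LHS]nomizuE //.
    transitivity (\sum_e \sum_b \sum_d w 0 b * z 0 d * (C a b e * levi_civita x e d a)).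
      apply: eq_bigr => e _; rewrite [RHS]exchange_big.
      apply: eq_bigr => d _; rewrite pbracket_pbasis.
      rewrite !mulr_suml; apply: eq_bigr => b _; ring.
    rewrite exchange_big; apply: eq_bigr => b _; rewrite exchange_big.
    by apply: eq_bigr => d _; rewrite mulr_sumr.
  - rewrite [LHS]torus_bracketE.
    under eq_bigr => k _ do under eq_bigr => b _ do under eq_bigr => d _ do
      rewrite -mulrA -mulrA.
    under eq_bigr => k _ do under eq_bigr => b _ do rewrite -mulr_sumr.
    under eq_bigr => k _ do rewrite -mulr_sumr.
    rewrite sum_pbasis; apply: eq_bigr => b _; apply: eq_bigr => d _.
    by rewrite mulrA.
  rewrite sub0r -!sumrN -!big_split; apply: eq_bigr => b _ /=.
  rewrite -!sumrN -!big_split; apply: eq_bigr => d _ /=.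
  by rewrite big_split /=; ring.
rewrite exchange_big; apply: eq_bigr => b _; rewrite exchange_big.
apply: eq_bigr => d _; rewrite -mulr_sumr; congr (_ * _).
rewrite big_split /= sumrN torus_const_sum opprK; congr (_ + _).
by rewrite sumrN.
Qed.

Lemma sum_const_sq a : \sum_b \sum_c C a b c ^+ 2 = 12.
Proof.
rewrite -(sum_adjacent R a); apply: eq_bigr => b _.
by rewrite structure_const_sum_sq.
Qed.

Lemma einstein_standard : einstein (standard_metric R 5).
Proof.
(* In this basis the metric is 20 times the identity and the Ricci matrix is 4 + 12/4 = 7 times the
   identity. *)
exists (7 / 20) => v w.
have -> : standard_metric R 5 = diag_form (fun=> 20).
  by rewrite standard_metricE; apply/matrixP => a b; rewrite !mxE.
rewrite ricciE => [|_]; last by rewrite pnatr_eq0.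
rewrite form_diag_form mulr_sumr; apply: eq_bigr => b _.
have coefE d : ricci_coef (fun=> 20) b d = 7 * (b == d)%:R.
  rewrite /ricci_coef.
  have -> : \sum_a \sum_e (levi_civita (fun=> 20) a d e * levi_civita (fun=> 20) b e a +
      C a b e * levi_civita (fun=> 20) e d a) =
      - 4^-1 * \sum_a \sum_e C a b e * C a d e.
    rewrite mulr_sumr; apply: eq_bigr => a _; rewrite mulr_sumr.
    apply: eq_bigr => e _; rewrite !levi_civita_cst.
    rewrite (structure_const_cyc R a b e) (structure_const_cyc R a e d).
    rewrite (structure_const_asym R e a d) -(structure_const_cyc R e a d).
    by move: (C a b e) (C a d e) => s t; field.
  (* For b = d this is the sum of all squared constants with one index fixed; for distinct b and d
     every product vanishes by [structure_const_mul0]. *)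
  have -> : \sum_a \sum_e C a b e * C a d e = 12 * (b == d)%:R.
    case: (eqVneq b d) => [<-|nbd].
      rewrite mulr1 -(sum_const_sq b).
      apply: eq_bigr => a _; apply: eq_bigr => e _.
      by rewrite structure_const_asym -expr2 sqrrN.
    rewrite mulr0; apply: big1 => a _; apply: big1 => e _.
    by rewrite (structure_const_cyc R e a b) (structure_const_cyc R e a d)
               structure_const_mul0.
  by field.
rewrite (bigD1 b) //= big1 => [|d nbd]; rewrite coefE.
  by rewrite eqxx addr0 mulr1; field.
by rewrite eq_sym (negPf nbd) !mulr0.
Qed.

Lemma sum3_cyc (F : 'I_N -> 'I_N -> 'I_N -> R) :
  \sum_a \sum_b \sum_c F a b c = \sum_a \sum_b \sum_c F b c a.
Proof. by rewrite [RHS]exchange_big; apply: eq_bigr => a _; apply: exchange_big. Qed.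

(* The formula of Wang and Ziller. *)
Lemma scalE x : (forall a, x a != 0) ->
  scal (diag_form x) =
  10 * \sum_a (x a)^-1 - 4^-1 * \sum_a \sum_b \sum_c C a b c ^+ 2 * (x c / (x a * x b)).
Proof.
move=> x_neq0; rewrite /scal gtrace_diag_form //.
pose K a b c := C a b c ^+ 2 / (x a * x b * x c).
have Kcyc a b c : K b c a = K a b c.
  rewrite /K structure_const_cyc; congr (_ / _); ring.
transitivity (\sum_b (4 / x b + \sum_a \sum_c K a b c *
    (- (x c ^+ 2 - (x b - x a) ^+ 2) / 4 + (x a * x c + x b * x c - x c ^+ 2) / 2))).
  apply: eq_bigr => b _; rewrite mxE ricciE //.
  transitivity ((x b)^-1 * ricci_coef x b b).
    congr (_ * _); under eq_bigr => c _ do under eq_bigr => d _ do rewrite -mulrA.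
    under eq_bigr => c _ do rewrite -mulr_sumr.
    by rewrite sum_pbasis sum_pbasis.
  rewrite /ricci_coef eqxx mulrBr mulr1 [_ * 4]mulrC; congr (_ + _).
  rewrite mulr_sumr -sumrN; apply: eq_bigr => a _.
  rewrite mulr_sumr -sumrN; apply: eq_bigr => c _.
  rewrite /levi_civita /K (structure_const_cyc R a b c) (structure_const_cyc R a c b).
  rewrite (structure_const_asym R c a b) -(structure_const_cyc R c a b).
  by field; rewrite !x_neq0.
(* [K] is invariant under cyclic shifts, so [S] takes one value on the three squares and one on the
   three products. *)
pose S F := \sum_a \sum_b \sum_c K a b c * F (x a) (x b) (x c).
have Scyc F : S (fun r s t => F s t r) = S F.
  rewrite /S [RHS]sum3_cyc; apply: eq_bigr => a _; apply: eq_bigr => b _.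
  by apply: eq_bigr => c _; rewrite (Kcyc a b c).
transitivity (4 * (\sum_a (x a)^-1) + S (fun r s t =>
   - (t ^+ 2 - (s - r) ^+ 2) / 4 + (r * t + s * t - t ^+ 2) / 2)).
  rewrite big_split mulr_sumr /S [X in _ = _ + X]exchange_big.
  by congr (_ + _).
(* Squares total -3/4 + 1/4 + 1/4 = -1/4. Products total -1/2 + 1/2 + 1/2 = 1/2, each worth 12
   \sum_a 1/x_a, which raises the coefficient 4 to 10. *)
have -> : S (fun r s t => - (t ^+ 2 - (s - r) ^+ 2) / 4 +
                          (r * t + s * t - t ^+ 2) / 2) =
    - (3 / 4) * S (fun r s t => t ^+ 2) + 4^-1 * S (fun r s t => r ^+ 2) +
    4^-1 * S (fun r s t => s ^+ 2) - 2^-1 * S (fun r s t => r * s) +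
    2^-1 * S (fun r s t => t * r) + 2^-1 * S (fun r s t => s * t).
  rewrite /S !mulr_sumr -sumrN -!big_split; apply: eq_bigr => a _ /=.
  rewrite !mulr_sumr -sumrN -!big_split; apply: eq_bigr => b _ /=.
  rewrite !mulr_sumr -sumrN -!big_split; apply: eq_bigr => c _ /=.
  by field.
have Sst : S (fun r s t => s * t) = S (fun r s t => r * s).
  exact: (Scyc (fun r s t => r * s)).
have Str : S (fun r s t => t * r) = S (fun r s t => s * t).
  exact: (Scyc (fun r s t => s * t)).
have Sr2 : S (fun r s t => r ^+ 2) = S (fun r s t => t ^+ 2).
  exact: (Scyc (fun r s t => t ^+ 2)).
have Ss2 : S (fun r s t => s ^+ 2) = S (fun r s t => r ^+ 2).
  exact: (Scyc (fun r s t => r ^+ 2)).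
have Sst12 : S (fun r s t => s * t) = 12 * \sum_a (x a)^-1.
  rewrite mulr_sumr; apply: eq_bigr => a _.
  rewrite -(sum_const_sq a) mulr_suml; apply: eq_bigr => b _.
  rewrite mulr_suml; apply: eq_bigr => c _; rewrite /K.
  by field; rewrite !x_neq0.
have -> : \sum_a \sum_b \sum_c C a b c ^+ 2 * (x c / (x a * x b)) =
    S (fun r s t => t ^+ 2).
  apply: eq_bigr => a _; apply: eq_bigr => b _; apply: eq_bigr => c _.
  by rewrite /K; field; rewrite !x_neq0.
by rewrite Str Ss2 Sr2 -Sst Sst12; field.
Qed.

End DiagonalMetric.

(** * Invariant tensors *)

Section TorusAction.
Variables (R : realType) (n : nat).
Local Notation N := (pdim n).
Implicit Types (a b : 'I_N) (p : 'I_n * 'I_n) (v w : 'rV[R]_N).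
Implicit Types (t X Z W : 'M[R[i]]_n).

Lemma su_basis_skew p k l : su_basis R p l k = - ((su_basis R p k l)^*)%C.
Proof.
case: p => i j; rewrite (@represents_basis R n (i, j) l k).
rewrite (@represents_basis R n (i, j) k l) /gval /int_basis /=.
rewrite ![(l == _ :> nat) && _]andbC.
by case: ifP => _; [|case: ifP => _]; do 2!case: (_ && _); apply/eqP;
  rewrite eq_complex /= ?(oppr0, opprK, eqxx).
Qed.

Lemma pvec_skew v k l : pvec v l k = - ((pvec v k l)^*)%C.
Proof.
rewrite /pvec !summxE rmorph_sum -sumrN; apply: eq_bigr => a _.
by rewrite !mxE su_basis_skew; case: (su_basis R _ _ _) => x y /=; simpc.
Qed.

Lemma su_coord_basis a b : su_coord (pidx a) (su_basis R (pidx b)) = (a == b)%:R.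
Proof.
rewrite -(inj_eq (@pidx_inj n)) (su_coord_represents _ (represents_basis R _)).
move: (pidx_neq a) (pidx_neq b); case: (pidx a) (pidx b) => i j [k l] /=.
rewrite xpair_eqE /int_coord /int_basis /= -!val_eqE /=.
case: (ltngtP i j) => // ij _; case: (ltngtP k l) => // kl _ /=.
- have -> : (i == l :> nat) && (j == k :> nat) = false by lia.
  by rewrite subr0.
- by have -> : (i == k :> nat) && (j == l :> nat) = false by lia.
- by have -> : (i == k :> nat) && (j == l :> nat) = false by lia.
- have -> : (i == l :> nat) && (j == k :> nat) = false by lia.
  by rewrite addr0.
Qed.

Lemma pcoordK v : pcoord (pvec v) = v.
Proof.
apply/rowP => a; rewrite mxE su_coord_sum (bigD1 a) //= big1 => [|b nba].
  by rewrite su_coord_basis eqxx mulr1 addr0.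
by rewrite su_coord_basis eq_sym (negPf nba) mulr0.
Qed.

Lemma pcoord_basis a : pcoord (su_basis R (pidx a)) = pbasis R a.
Proof. by rewrite -pvec_pbasis pcoordK. Qed.

Lemma pcoordZ (r : R) Z : pcoord (r%:C *: Z) = r *: pcoord Z.
Proof.
apply/rowP => a; rewrite !mxE.
have := @su_coord_sum R n (pidx a) 'I_1 (fun=> r) (fun=> Z).
by rewrite !big_ord1.
Qed.

Lemma max_torusP t : max_torus t ->
  exists2 d : 'rV[R[i]]_n, t = diag_mx d & forall k, d 0 k * (d 0 k)^*%C = 1.
Proof.
case=> /diag_mxP[d ->] tt1 _; exists d => // k.
have /matrixP/(_ k k) := tt1.
by rewrite mul_diag_mx !mxE eqxx !mulr1n.
Qed.

Lemma AdE (d : 'rV[R[i]]_n) X k l : (forall k, d 0 k * (d 0 k)^*%C = 1) ->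
  Ad (diag_mx d) X k l = d 0 k * X k l * (d 0 l)^*%C.
Proof.
move=> dd1; have dd : diag_mx d *m diag_mx (map_mx (@conjc R) d) = 1%:M.
  apply/matrixP => i j; rewrite mul_diag_mx !mxE.
  by case: eqP => [->|_]; rewrite ?mulr0 ?mulr1n.
have [d_unit _] := mulmx1_unit dd.
have -> : Ad (diag_mx d) X = diag_mx d *m X *m diag_mx (map_mx (@conjc R) d).
  by rewrite /Ad -[in RHS](mulKmx d_unit (diag_mx (map_mx _ _))) dd mulmx1.
by rewrite mul_mx_diag mul_diag_mx !mxE.
Qed.

Lemma diag_mx_unitary (d : 'rV[R[i]]_n) : (forall k, d 0 k * (d 0 k)^*%C = 1) ->
  diag_mx d *m (map_mx (@conjc R) (diag_mx d))^T = 1%:M.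
Proof.
move=> dd1; apply/matrixP => k l; rewrite mul_diag_mx !mxE eq_sym.
by case: eqVneq => [->|_]; rewrite ?mulr1n ?dd1 // !mulr0n conjc0 mulr0.
Qed.

Lemma max_torus_pair (i m : 'I_n) (z : R[i]) : i != m -> z * z^*%C = 1 ->
  let d := \row_k (if k == i then z else if k == m then z^*%C else 1) in
  max_torus (diag_mx d) /\ forall k, d 0 k * (d 0 k)^*%C = 1.
Proof.
move=> nim zz1 d.
have dd1 k : d 0 k * (d 0 k)^*%C = 1.
  rewrite mxE; case: ifP => // _; case: ifP => // _.
    by rewrite conjcK mulrC.
  by rewrite conjc1 mulr1.
split=> //; split; first exact: diag_mx_is_diag.
  exact: diag_mx_unitary.
rewrite det_diag (bigD1 i) //= (bigD1 m) 1?eq_sym //= big1 => [|k /andP[nki nkm]].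
  by rewrite !mxE !eqxx eq_sym (negPf nim) mulr1.
by rewrite mxE (negPf nki) (negPf nkm).
Qed.

(** Each [t] that maps basis vectors to multiples of basis vectors gives one relation between
    entries of [S]; well chosen [t] then determine the shape of [S]. *)
Lemma invariantE (S : 'M[R]_N) a b a' b' (r s : R) t :
  invariant_tensor S -> max_torus t ->
  Ad t (su_basis R (pidx a)) = r%:C *: su_basis R (pidx a') ->
  Ad t (su_basis R (pidx b)) = s%:C *: su_basis R (pidx b') ->
  S a b = r * s * S a' b'.
Proof.
move=> [_ S_inv] t_torus Ada Adb.
have formE (c d : 'I_N) (x y : R) :
    form S (x *: pbasis R c) (y *: pbasis R d) = x * y * S c d.
  rewrite /form linearZ /= -!scalemxAl -scalemxAr !mxE (bigD1 d) //= big1 => [|k nkd].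
    by rewrite -rowE !mxE !eqxx /= addr0 ; ring.
  by rewrite !mxE (negPf nkd) andbF mulr0.
have := S_inv _ t_torus (pbasis R a) (pbasis R b).
rewrite !pvec_pbasis Ada Adb !pcoordZ !pcoord_basis formE => ->.
by have := formE a b 1 1; rewrite !scale1r !mul1r.
Qed.

End TorusAction.

(** * Invariant tensors on F(5) as weights on the edges of K_5 *)

Section InvariantTensors.
Variable R : realType.

Lemma su_basis_support n (k l u v : 'I_n) : k != l ->
  (u, v) != (k, l) -> (u, v) != (l, k) -> su_basis R (k, l) u v = 0.
Proof.
rewrite -val_eqE !xpair_eqE /su_basis /= => nkl n1 n2.
case: (ltngtP k l) nkl => // _ _.
  by rewrite !mxE (negPf n1) (negPf n2) subr0.
by rewrite !mxE (negPf n1) (negPf n2) addr0 mulr0.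
Qed.

Lemma mulcJ_swap (z w : R[i]) : w * (z^*)%C = ((z * (w^*)%C)^*)%C.
Proof. by case: z w => a b [c d]; simpc; congr (_ +i* _); ring. Qed.

Lemma Ad_su_basis_real n (d : 'rV[R[i]]_n) (k l : 'I_n) (r : R) :
  (forall k, d 0 k * (d 0 k)^*%C = 1) -> k != l -> d 0 k * (d 0 l)^*%C = r%:C ->
  Ad (diag_mx d) (su_basis R (k, l)) = r%:C *: su_basis R (k, l).
Proof.
move=> dd1 nkl dkl; apply/matrixP => u v; rewrite AdE // [RHS]mxE mulrAC.
case: (eqVneq (u, v) (k, l)) => [[-> ->]|n1]; first by rewrite dkl.
case: (eqVneq (u, v) (l, k)) => [[-> ->]|n2]; last first.
  by rewrite su_basis_support // !mulr0.
by rewrite mulcJ_swap dkl conjc_real.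
Qed.

(** Multiplying the (k, l) entry by i exchanges real and imaginary parts: a quarter turn of the
    plane p_kl. *)
Lemma Ad_su_basis_quarter n (d : 'rV[R[i]]_n) (k l : 'I_n) :
  (forall k, d 0 k * (d 0 k)^*%C = 1) -> (k < l)%N -> d 0 k * (d 0 l)^*%C = 'i%C ->
  Ad (diag_mx d) (su_basis R (k, l)) = 1%:C *: su_basis R (l, k) /\
  Ad (diag_mx d) (su_basis R (l, k)) = (-1)%:C *: su_basis R (k, l).
Proof.
move=> dd1 ltkl dkl.
have nkl : k != l by rewrite -val_eqE ltn_eqF.
have dlk : d 0 l * (d 0 k)^*%C = - 'i%C.
  by rewrite mulcJ_swap dkl; simpc.
split; apply/matrixP => u v; rewrite AdE // [RHS]mxE mulrAC.
all: case: (eqVneq (u, v) (k, l)) => [[-> ->]|n1]; [rewrite dkl|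
  case: (eqVneq (u, v) (l, k)) => [[-> ->]|n2]; [rewrite dlk|
    by rewrite !su_basis_support ?mulr0 // eq_sym]].
all: rewrite /su_basis ltkl (ltnNge l k) (ltnW ltkl) /= !mxE !eqxx.
all: rewrite ?(negPf nkl) ?[l == k]eq_sym ?(negPf nkl) /=; simpc.
all: by [].
Qed.

Local Notation N := (pdim 5).
Implicit Types (a b : 'I_N) (S : 'M[R]_N) (y : 'I_5 * 'I_5 -> R).

(** Provides a vertex off two given edges, where a torus element can carry the inverse entry that
    makes its determinant 1. *)
Lemma ord5_avoid (i j k l : 'I_5) : exists m, m \notin [:: i; j; k; l].
Proof.
apply/existsP; apply: contraT; rewrite negb_exists => /forallP all_in.
have : (#|'I_5| <= size [:: i; j; k; l])%N.
  apply: leq_trans (card_size _); apply: subset_leq_card; apply/fintype.subsetP => m _.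
  by have := all_in m; rewrite negbK.
by rewrite card_ord.
Qed.

Definition swap (T : Type) (p : T * T) : T * T := (p.2, p.1).

Lemma invariant_off_block S a b : invariant_tensor S ->
  pidx b != pidx a -> pidx b != swap (pidx a) -> S a b = 0.
Proof.
move=> S_inv; move: (pidx_neq a) (pidx_neq b).
case ea: (pidx a) => [i j]; case eb: (pidx b) => [k l].
rewrite !xpair_eqE /swap /= => nij nkl n1 n2.
have [m] := ord5_avoid i j k l; rewrite !inE !negb_or => /and4P[nmi nmj nmk nml].
have N1 : (-1 : R[i]) * ((-1)^*)%C = 1 by simpc.
(* Acting by -1 on e_a and by 1 on e_b forces S a b = - S a b. *)
suff [t [t_torus Ada Adb]] : exists t, [/\ max_torus t,
    Ad t (su_basis R (pidx a)) = (-1)%:C *: su_basis R (pidx a) &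
    Ad t (su_basis R (pidx b)) = 1%:C *: su_basis R (pidx b)].
  by have := invariantE S_inv t_torus Ada Adb; lra.
(* An endpoint [u] of the first edge that is off the second; the torus element has -1 at [u] and at
   the spare vertex [m]. *)
have [u [nuk nul u_ij]] : exists u, [/\ u != k, u != l & (u == i) (+) (u == j)].
  have [ik|/norP[nik nil]] := boolP ((i == k) || (i == l)); last first.
    by exists i; rewrite eqxx (negPf nij) nik nil.
  have nji : j != i by rewrite eq_sym.
  exists j; rewrite eqxx addbT nji.
  case/orP: ik => /eqP eik; move: n1 n2; rewrite -eik eqxx ?andbT /=.
    by move=> n1 _; rewrite nji (eq_sym j l) n1.
  by move=> _ n2; rewrite nji (eq_sym j k) n2.
have num : u != m by apply: contraTneq u_ij => ->; rewrite (negPf nmi) (negPf nmj).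
have [t_torus dd1] := max_torus_pair num N1.
set d := \row__ _ in t_torus dd1; exists (diag_mx d); split => //.
  rewrite ea; apply: Ad_su_basis_real => //.
  rewrite !mxE ![_ == m]eq_sym (negPf nmi) (negPf nmj) ![_ == u]eq_sym.
  by case: (u == i) (u == j) u_ij => -[]; simpc.
rewrite eb; apply: Ad_su_basis_real => //.
rewrite !mxE ![_ == m]eq_sym (negPf nmk) (negPf nml) ![_ == u]eq_sym.
by rewrite (negPf nuk) (negPf nul) conjc1 mulr1.
Qed.

Lemma invariant_in_block S a b : invariant_tensor S ->
  pidx b = swap (pidx a) -> S a b = 0 /\ S b b = S a a.
Proof.
wlog ltab : a b / ((pidx a).1 < (pidx a).2)%N => [IH|] S_inv eba.
  have [ltab|ltba|/val_inj eqa] := ltngtP (pidx a).1 (pidx a).2.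
  - exact: IH.
  - have lt_b : ((pidx b).1 < (pidx b).2)%N by rewrite eba.
    have eab : pidx a = swap (pidx b) by rewrite eba; case: (pidx a).
    have [Sba ->] := IH b a lt_b S_inv eab; split => //.
    by have /matrixP/(_ a b) := S_inv.1; rewrite mxE => <-.
  - by have := pidx_neq a; rewrite eqa eqxx.
move: ltab; case ea: (pidx a) eba => [k l]; rewrite /swap /= => eb ltkl.
have nkl : k != l by rewrite -val_eqE ltn_eqF.
have [m] := ord5_avoid k l l l; rewrite !inE !negb_or => /and4P[nmk nml _ _].
have ii1 : ('i%C : R[i]) * ('i%C^*)%C = 1 by simpc.
have nkm : k != m by rewrite eq_sym.
have [t_torus dd1] := max_torus_pair nkm ii1.
set d := \row__ _ in t_torus dd1.
have dkl : d 0 k * (d 0 l)^*%C = 'i%C.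
  by rewrite !mxE eqxx eq_sym (negPf nkl) eq_sym (negPf nml) conjc1 mulr1.
have [Ada Adb] := Ad_su_basis_quarter dd1 ltkl dkl.
rewrite -ea -eb in Ada Adb.
(* The quarter turn gives S a a = S b b and S a b = - S b a; the latter vanishes by symmetry. *)
have := invariantE S_inv t_torus Ada Ada; have := invariantE S_inv t_torus Ada Adb.
have /matrixP/(_ a b) := S_inv.1; rewrite mxE => ->.
by split; lra.
Qed.

Definition sym_weight y := forall p, y (swap p) = y p.

Definition pair_form y : 'M[R]_N := diag_form (fun a => y (pidx a)).

(** The sum has at most one term; it extends the diagonal of [S] by 0 to the pairs (i, i). *)
Definition weight S (p : 'I_5 * 'I_5) : R := \sum_(a | pidx a == p) S a a.

Lemma weight_pidx S a : weight S (pidx a) = S a a.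
Proof.
by rewrite /weight (big_pred1 a) // => b; rewrite (inj_eq (@pidx_inj 5)).
Qed.

Lemma weight_sym S : invariant_tensor S -> sym_weight (weight S).
Proof.
move=> S_inv p; have [eqp|nep] := eqVneq p.1 p.2.
  by congr weight; case: p eqp => i j /= ->.
have [a ea] := pidx_surj nep.
have nep' : (swap p).1 != (swap p).2 by rewrite eq_sym.
have [b eb] := pidx_surj nep'.
rewrite -eb -ea !weight_pidx; apply: (invariant_in_block S_inv _).2.
by rewrite eb ea.
Qed.

Lemma invariant_weight S : invariant_tensor S -> S = pair_form (weight S).
Proof.
move=> S_inv; apply/matrixP => a b; rewrite diag_formE weight_pidx.
case: (eqVneq a b) => [<-|nab]; first by rewrite mulr1n.
rewrite mulr0n; have [eba|neba] := eqVneq (pidx b) (swap (pidx a)).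
  exact: (invariant_in_block S_inv eba).1.
by apply: invariant_off_block => //; rewrite (inj_eq (@pidx_inj 5)) eq_sym.
Qed.

Lemma pair_form_invariant y : sym_weight y -> invariant_tensor (pair_form y).
Proof.
move=> y_sym; split; first by rewrite tr_diag_mx.
(* The two coordinates of a block are the real and imaginary parts of one matrix entry. The form
   becomes a weighted sum of Re(Z_ij conj(W_ij)), unchanged when both entries are multiplied by the
   same phase. *)
have formE (Z W : 'M[R[i]]_5) : (forall k l, Z l k = - ((Z k l)^*)%C) ->
    (forall k l, W l k = - ((W k l)^*)%C) ->
    form (pair_form y) (pcoord Z) (pcoord W) =
    \sum_(p : 'I_5 * 'I_5 | (p.1 < p.2)%N) y p * complex.Re (Z p.1 p.2 * ((W p.1 p.2)^*)%C).
  move=> skewZ skewW; rewrite form_diag_form.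
  under eq_bigr => a _ do rewrite !mxE.
  rewrite (sum_pidx (fun p => y p * su_coord p Z * su_coord p W)).
  rewrite (bigID (fun p : 'I_5 * 'I_5 => (p.1 < p.2)%N)) /=.
  rewrite [X in _ + X](reindex_inj (h := @swap _)) /=; last by case=> ? ? [? ?] [-> ->].
  rewrite (eq_bigl (fun p : 'I_5 * 'I_5 => (p.1 < p.2)%N)) => [|p]; last first.
    by rewrite -val_eqE /=; lia.
  rewrite [X in _ + X](eq_bigl (fun p : 'I_5 * 'I_5 => (p.1 < p.2)%N)) => [|p]; last first.
    by rewrite -val_eqE /=; lia.
  rewrite -big_split; apply: eq_bigr => p ltp /=.
  rewrite y_sym /su_coord ltp [(swap p).1]/= [(swap p).2]/= ltnNge (ltnW ltp) /=.
  rewrite (skewZ p.1) (skewW p.1).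
  by case: (Z _ _) (W _ _) => ? ? [? ?] /=; ring.
move=> t /max_torusP[d -> dd1] v w.
have Ad_skew u k l : Ad (diag_mx d) (pvec u) l k = - ((Ad (diag_mx d) (pvec u) k l)^*)%C.
  rewrite !AdE // (pvec_skew u k l) mulrN mulNr !rmorphM /= conjcK.
  by congr (- _); rewrite mulrAC [_ * ((d 0 k)^*)%C]mulrC mulrAC.
rewrite -[in RHS](pcoordK v) -[in RHS](pcoordK w).
rewrite (formE _ _ (Ad_skew v) (Ad_skew w)) (formE _ _ (pvec_skew v) (pvec_skew w)).
apply: eq_bigr => p _; rewrite !AdE //; congr (_ * complex.Re _).
rewrite !rmorphM /= conjcK -[RHS]mulr1 -(dd1 p.1) -[RHS]mulr1 -(dd1 p.2); ring.
Qed.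
End InvariantTensors.

(** * The Hessian of the scalar curvature *)

Section SecondDerivative.
Variable R : realType.

(** The iterated derivative of [scal_hessian] in relational form; the inner derivative is only
    required for [s] near 0. *)
Definition has_hessian (f : R -> R -> R) (h : R) : Prop :=
  exists2 d : R -> R, (\forall s \near 0, is_derive (0 : R) 1 (f s) (d s)) &
    is_derive (0 : R) 1 d h.

Lemma has_hessianE f h : has_hessian f h -> derive1 (fun s => derive1 (f s) 0) 0 = h.
Proof.
case=> d f_d d_h; rewrite derive1E.
have d_h' : is_derive (0 : R) 1 (fun s => derive1 (f s) 0) h.
  apply: near_eq_is_derive d_h; near=> s.
  have f_ds : is_derive (0 : R) 1 (f s) (d s) by near: s.
  by rewrite derive1E derive_val.
by rewrite derive_val.
Unshelve. all: by end_near. Qed.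

Lemma near_has_hessian f g h :
  (\forall s \near 0, \forall t \near 0, f s t = g s t) ->
  has_hessian f h -> has_hessian g h.
Proof.
move=> fg [d f_d d_h]; exists d => //; near=> s.
apply: (@near_eq_is_derive _ _ _ (f s)); first by near: s.
by near: s.
Unshelve. all: by end_near. Qed.

Lemma has_hessianD f g h k : has_hessian f h -> has_hessian g k ->
  has_hessian (fun s t => f s t + g s t) (h + k).
Proof.
move=> [d f_d d_h] [e g_e e_k]; exists (fun s => d s + e s).
  near=> s; apply: is_deriveD; near: s; assumption.
exact: is_deriveD.
Unshelve. all: by end_near. Qed.

Lemma has_hessianZ (c : R) f h :
  has_hessian f h -> has_hessian (fun s t => c * f s t) (c * h).
Proof.
move=> [d f_d d_h]; exists (fun s => c * d s).
  near=> s; apply: is_deriveZ; near: s; assumption.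
exact: is_deriveZ.
Unshelve. all: by end_near. Qed.

Lemma has_hessian_sum n (f : 'I_n -> R -> R -> R) h :
  (forall i, has_hessian (f i) (h i)) ->
  has_hessian (fun s t => \sum_i f i s t) (\sum_i h i).
Proof.
elim: n f h => [|n IHn] f h f_h.
  rewrite big_ord0; exists (fun=> 0); last exact: is_derive_cst.
  near=> s; have -> : (fun t => \sum_i f i s t) = cst 0.
    by apply/funext => t; rewrite big_ord0.
  exact: is_derive_cst.
have := has_hessianD (f_h ord0) (IHn _ _ (fun i => f_h (lift ord0 i))).
rewrite -big_ord_recl; congr has_hessian.
by apply/funext => s; apply/funext => t; rewrite big_ord_recl.
Unshelve. all: by end_near. Qed.

Lemma near0_affine_gt0 (p q : R) : 0 < p -> \forall t \near (0 : R), 0 < p + t * q.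
Proof.
(* Adding 1 keeps the denominator positive when q = 0. *)
move=> p_gt0; have q1_gt0 : 0 < `|q| + 1 by rewrite ltr_wpDl.
have e_gt0 : 0 < p / (`|q| + 1) by rewrite divr_gt0.
have t_small : \forall t \near (0 : R), `|t| < p / (`|q| + 1) := nbhs0_lt e_gt0.
apply: filterS t_small => t; rewrite ltr_pdivlMr // => t_small.
have : - (`|t| * `|q|) <= t * q by rewrite -normrM lerNl -normrN ler_norm.
have := normr_ge0 t; lra.
Qed.

Variable N : nat.
Implicit Types (m x sigma tau : 'I_N -> R).

(** For positive [x], the product of the powers (x a)^(m a) with real exponents. *)
Definition monomial m x : R := expR (\sum_a m a * ln (x a)).

Lemma is_derive_linear_sum n (f : 'I_n -> R -> R) (df : 'I_n -> R) (x : R) :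
  (forall i, is_derive x 1 (f i) (df i)) ->
  is_derive x 1 (fun t => \sum_i f i t) (\sum_i df i).
Proof.
move=> f_df; have -> : (fun t => \sum_i f i t) = \sum_i f i.
  by apply/funext => t; rewrite fct_sumE.
exact: is_derive_sum.
Qed.

Lemma is_derive_affine (p q : R) : is_derive (0 : R) 1 (fun t => p + t * q) q.
Proof.
rewrite -[X in is_derive _ _ _ X](_ : 0 + q *: 1 = q); last first.
  by rewrite add0r [_ *: _]mulr1.
apply: is_deriveD; have -> : (fun t => t * q) = (fun t => q * t).
  by apply/funext => t; rewrite mulrC.
exact: is_deriveZ.
Qed.

Lemma is_derive_monomial m x tau : (forall a, 0 < x a) ->
  is_derive (0 : R) 1 (fun t => monomial m (fun a => x a + t * tau a))
    (monomial m x * \sum_a m a * (tau a / x a)).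
Proof.
move=> x_gt0; have x0 a : x a + 0 * tau a = x a by rewrite mul0r addr0.
have -> : monomial m x = expR (\sum_a m a * ln (x a + 0 * tau a)).
  by congr expR; apply: eq_bigr => a _; rewrite x0.
apply: (@is_derive1_comp _ expR (fun t => \sum_a m a * ln (x a + t * tau a))).
apply: is_derive_linear_sum => a; apply: is_deriveZ.
rewrite [tau a / x a]mulrC -[in (x a)^-1](x0 a).
apply: (@is_derive1_comp _ (@ln R) (fun t => x a + t * tau a));
  last exact: is_derive_affine.
by apply: is_derive1_ln; rewrite x0.
Qed.

(** Degree 0 gives the monomial the value 1 at the constant point, so its second derivative is the
    product of the two logarithmic derivatives plus the second derivative of the logarithm. *)
Lemma has_hessian_monomial m (kappa : R) sigma tau : 0 < kappa -> \sum_a m a = 0 ->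
  has_hessian (fun s t => monomial m (fun a => kappa + s * sigma a + t * tau a))
    (kappa ^- 2 * ((\sum_a m a * sigma a) * (\sum_a m a * tau a) -
                   \sum_a m a * (sigma a * tau a))).
Proof.
move=> k_gt0 sum_m0.
exists (fun s => monomial m (fun a => kappa + s * sigma a) *
    \sum_a m a * (tau a / (kappa + s * sigma a))).
  have : \forall s \near (0 : R), forall a, 0 < kappa + s * sigma a.
    apply: (@filter_forall R 'I_N (fun a s => 0 < kappa + s * sigma a)
      (nbhs (0 : R)) _) => a.
    exact: near0_affine_gt0.
  by apply: filterS => s s_gt0; apply: is_derive_monomial.
have mono1 : monomial m (fun=> kappa) = 1.
  by rewrite /monomial -mulr_suml sum_m0 mul0r expR0.
have k0 a : kappa + 0 * sigma a = kappa by rewrite mul0r addr0.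
pose dm : R := monomial m (fun=> kappa) * \sum_a m a * (sigma a / kappa).
pose dl : R := \sum_a m a * (tau a * (- kappa ^- 2 * sigma a)).
have d1 : is_derive (0 : R) 1 (fun s => monomial m (fun a => kappa + s * sigma a)) dm.
  exact: is_derive_monomial.
have d2 : is_derive (0 : R) 1
    (fun s => \sum_a m a * (tau a / (kappa + s * sigma a))) dl.
  apply: is_derive_linear_sum => a; apply: is_deriveZ; apply: is_deriveZ.
  apply: is_derive_eq.
    apply: (@is_deriveV R (fun s => kappa + s * sigma a) 0 (sigma a) 1).
      by rewrite k0 gt_eqF.
    exact: is_derive_affine.
  by rewrite /= k0.
apply: (is_derive_eq (is_deriveM d1 d2)).
rewrite /dm /dl /=.
have -> : monomial m (fun a => kappa + 0 * sigma a) = 1.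
  by rewrite -mono1; congr monomial; apply/funext.
have -> : \sum_a m a * (tau a / (kappa + 0 * sigma a)) = \sum_a m a * (tau a / kappa).
  by apply: eq_bigr => a _; rewrite k0.
rewrite mono1 scale1r mul1r.
have sum_div f : \sum_a m a * (f a / kappa) = (\sum_a m a * f a) / kappa.
  by rewrite mulr_suml; apply: eq_bigr => a _; rewrite mulrA.
rewrite !sum_div mulrBr addrC; congr (_ + _).
  rewrite [_ *: _]mulrC.
  by field; rewrite gt_eqF.
rewrite mulr_sumr -sumrN; apply: eq_bigr => a _; ring.
Qed.

End SecondDerivative.

(** * The Hessian of the scalar curvature at multiples of the standard metric *)

Section Stability.
Variables (R : realType) (V0 : R).
Hypothesis V0_gt0 : 0 < V0.
Local Notation N := (pdim 5).
Local Notation C := (structure_const R).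
Implicit Types (a b c e : 'I_N) (x sigma tau : 'I_N -> R) (S : 'M[R]_N).
Implicit Types (y z : 'I_5 * 'I_5 -> R).

Lemma pdim5_neq0 : N%:R != 0 :> R.
Proof.
have [a _] := @pidx_surj 5 (ord0, ord_max) isT.
by rewrite pnatr_eq0 -lt0n; apply: leq_ltn_trans (ltn_ord a).
Qed.

(* With N = 20, x |-> (\prod_a x_a)^(1/N) / x_b and
   x |-> (\prod_a x_a)^(1/N) * x_c / (x_a * x_b) are the monomials with these
   exponents. *)
Definition exponent1 b e : R := N%:R^-1 - (e == b)%:R.
Definition exponent2 a b c e : R :=
  N%:R^-1 + (e == c)%:R - (e == a)%:R - (e == b)%:R.

Lemma sum_exponent1 b (f : 'I_N -> R) :
  \sum_e exponent1 b e * f e = N%:R^-1 * (\sum_e f e) - f b.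
Proof.
under eq_bigr => e _ do rewrite mulrBl.
by rewrite sumrB sum_delta mulr_sumr.
Qed.

Lemma sum_exponent2 a b c (f : 'I_N -> R) :
  \sum_e exponent2 a b c e * f e = N%:R^-1 * (\sum_e f e) + f c - f a - f b.
Proof.
under eq_bigr => e _ do rewrite 2!mulrBl mulrDl.
by rewrite 2!sumrB big_split /= !sum_delta mulr_sumr.
Qed.

Definition scal_monomials x : R :=
  10 * \sum_b monomial (exponent1 b) x -
  4^-1 * \sum_a \sum_b \sum_c C a b c ^+ 2 * monomial (exponent2 a b c) x.

Lemma scalar_diag_form (r : R) : r%:M = diag_form (fun=> r).
Proof. by apply/matrixP => a b; rewrite !mxE. Qed.

Lemma unit_rescale_diag x :
  unit_rescale V0 (diag_form x) =
  diag_form (fun a => volume V0 (diag_form x) `^ (- (2 / N%:R)) * x a).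
Proof. by apply/matrixP => a b; rewrite !mxE mulrnAr. Qed.

Lemma volumeE x : (forall a, 0 < x a) ->
  volume V0 (diag_form x) =
  expR (ln V0 + (\sum_a ln (x a) - N%:R * ln 20) / 2).
Proof.
move=> x_gt0; rewrite /volume standard_metricE det_scalar det_diag.
have -> : \prod_a (\row_a x a) 0 a = expR (\sum_a ln (x a)).
  rewrite (big_morph expR (@expRD R) (expR0 R)); apply: eq_bigr => a _.
  by rewrite mxE lnK // posrE.
have -> : (20 : R) ^+ N = expR (N%:R * ln 20).
  by rewrite expRM_natl lnK // posrE.
rewrite -expRN -expRD [RHS]expRD lnK ?posrE //; congr (_ * _).
set u := _ - _; have -> : expR u = expR (u / 2) ^+ 2.
  by rewrite -expRM_natl; congr expR; field.
by rewrite sqrtr_sqr ger0_norm ?expR_ge0.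
Qed.

Lemma scal_unit_rescale : exists2 M : R, 0 < M &
  forall x, (forall a, 0 < x a) ->
    scal (unit_rescale V0 (diag_form x)) = M * scal_monomials x.
Proof.
exists (expR (2 / N%:R * ln V0 - ln 20)); first exact: expR_gt0.
move=> x x_gt0; have x_neq0 a : x a != 0 by rewrite gt_eqF.
rewrite unit_rescale_diag; set lambda := _ `^ _.
have lambda_gt0 : 0 < lambda by rewrite powR_gt0 // volumeE // expR_gt0.
have lambda_neq0 : lambda != 0 by rewrite gt_eqF.
rewrite scalE => [|a]; last by rewrite mulf_neq0.
(* [lambda] is the volume to the power -2/N, and scaling the metric by it divides Sc by it. The
   inverse thus supplies (\prod_a x_a)^(1/N) times the constant chosen as witness. *)
have lambdaV : lambda^-1 = expR (2 / N%:R * ln V0 - ln 20) *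
                           expR (N%:R^-1 * \sum_a ln (x a)).
  rewrite /lambda volumeE // /powR gt_eqF ?expR_gt0 // expRK -expRN -expRD.
  congr expR; move: pdim5_neq0; move: (N%:R : R) => n n_neq0; by field.
rewrite /scal_monomials mulrBr mulrCA [_ * (4^-1 * _)]mulrCA.
congr (_ * _ - _ * _).
  rewrite mulr_sumr; apply: eq_bigr => b _.
  rewrite invfM lambdaV -[LHS]mulrA; congr (_ * _).
  by rewrite /monomial (sum_exponent1 b (fun e => ln (x e))) expRD expRN lnK // posrE.
rewrite mulr_sumr; apply: eq_bigr => a _; rewrite mulr_sumr; apply: eq_bigr => b _.
rewrite mulr_sumr; apply: eq_bigr => c _; rewrite [RHS]mulrCA; congr (_ * _).
transitivity (lambda^-1 * (x c / (x a * x b))).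
  by field; rewrite lambda_neq0 !x_neq0.
rewrite lambdaV -[LHS]mulrA; congr (_ * _).
rewrite /monomial (sum_exponent2 a b c (fun e => ln (x e))) !expRD !expRN !lnK ?posrE //.
by field; rewrite !x_neq0.
Qed.

Lemma unit_rescale_standard : exists2 kappa : R, 0 < kappa &
  unit_rescale V0 (standard_metric R 5) = diag_form (fun=> kappa).
Proof.
rewrite standard_metricE scalar_diag_form unit_rescale_diag.
exists (volume V0 (diag_form (fun=> 20 : R)) `^ (- (2 / N%:R)) * 20) => //.
by rewrite mulr_gt0 // powR_gt0 // volumeE // expR_gt0.
Qed.

Definition hessian_form sigma tau : R :=
  \sum_a sigma a * tau a +
  2^-1 * \sum_a \sum_b (adjacent (pidx a) (pidx b))%:R * (sigma a * tau b).

Lemma structure_const_sum1 (f : 'I_N -> R) :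
  [/\ \sum_a \sum_b \sum_c C a b c ^+ 2 * f a = 12 * \sum_a f a,
      \sum_a \sum_b \sum_c C a b c ^+ 2 * f b = 12 * \sum_a f a &
      \sum_a \sum_b \sum_c C a b c ^+ 2 * f c = 12 * \sum_a f a].
Proof.
have Sa : \sum_a \sum_b \sum_c C a b c ^+ 2 * f a = 12 * \sum_a f a.
  rewrite mulr_sumr; apply: eq_bigr => a _; rewrite -(sum_const_sq R a).
  by rewrite !mulr_suml; apply: eq_bigr => b _; rewrite mulr_suml.
have Sc : \sum_a \sum_b \sum_c C a b c ^+ 2 * f c = 12 * \sum_a f a.
  rewrite -Sa [LHS]sum3_cyc; apply: eq_bigr => a _; apply: eq_bigr => b _.
  by apply: eq_bigr => c _; rewrite structure_const_cyc.
split => //; rewrite -Sc [LHS]sum3_cyc; apply: eq_bigr => a _; apply: eq_bigr => b _.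
by apply: eq_bigr => c _; rewrite structure_const_cyc.
Qed.

(** Of the nine products, the three with equal indices give 12 each. By cyclicity each of the six
    mixed ones gives the adjacency sum, two with sign + and four with sign -. *)
Lemma structure_const_form sigma tau :
  \sum_a \sum_b \sum_c C a b c ^+ 2 *
    ((sigma c - sigma a - sigma b) * (tau c - tau a - tau b)) =
  36 * (\sum_a sigma a * tau a) -
  2 * \sum_a \sum_b (adjacent (pidx a) (pidx b))%:R * (sigma a * tau b).
Proof.
pose S (F : 'I_N -> 'I_N -> 'I_N -> R) := \sum_a \sum_b \sum_c C a b c ^+ 2 * F a b c.
have Scyc F : S (fun a b c => F b c a) = S F.
  rewrite /S [RHS]sum3_cyc; apply: eq_bigr => a _; apply: eq_bigr => b _.
  by apply: eq_bigr => c _; rewrite (structure_const_cyc R a b c).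
have Sdiag : S (fun a b c => sigma a * tau a) = 12 * \sum_a sigma a * tau a.
  rewrite mulr_sumr; apply: eq_bigr => a _; rewrite -(sum_const_sq R a).
  by rewrite !mulr_suml; apply: eq_bigr => b _; rewrite mulr_suml.
have Sadj (f g : 'I_N -> R) : S (fun a b c => f a * g b) =
    \sum_a \sum_b (adjacent (pidx a) (pidx b))%:R * (f a * g b).
  apply: eq_bigr => a _; apply: eq_bigr => b _.
  by rewrite -structure_const_sum_sq mulr_suml.
have Sadj' : S (fun a b c => tau a * sigma b) = S (fun a b c => sigma a * tau b).
  rewrite /S [LHS]exchange_big; apply: eq_bigr => a _; apply: eq_bigr => b _.
  by apply: eq_bigr => c _; rewrite structure_const_asym sqrrN [sigma a * _]mulrC.
transitivity (S (fun a b c => sigma c * tau c) + S (fun a b c => sigma a * tau a) +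
    S (fun a b c => sigma b * tau b) + S (fun a b c => sigma a * tau b) +
    S (fun a b c => tau a * sigma b) - S (fun a b c => sigma c * tau a) -
    S (fun a b c => tau b * sigma c) - S (fun a b c => tau c * sigma a) -
    S (fun a b c => sigma b * tau c)).
  rewrite /S -!sumrN -!big_split; apply: eq_bigr => a _ /=.
  rewrite -!sumrN -!big_split; apply: eq_bigr => b _ /=.
  rewrite -!sumrN -!big_split; apply: eq_bigr => c _ /=.
  by move: (C a b c) => k; ring.
have d1 := Scyc (fun a b c => sigma a * tau a).
have d2 := Scyc (fun a b c => sigma b * tau b).
have e1 := Scyc (fun a b c => sigma a * tau b).
have e2 := Scyc (fun a b c => sigma b * tau c).
have e3 := Scyc (fun a b c => tau a * sigma b).
have e4 := Scyc (fun a b c => tau b * sigma c).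
rewrite /= in d1 d2 e1 e2 e3 e4.
rewrite d2 d1 Sdiag e2 e1 e4 e3 Sadj' Sadj.
by ring.
Qed.

Lemma scal_hessian_diag (kappa : R) : 0 < kappa ->
  exists2 K : R, 0 < K & forall sigma tau,
    \sum_a sigma a = 0 -> \sum_a tau a = 0 ->
    scal_hessian V0 (diag_form (fun=> kappa)) (diag_form sigma) (diag_form tau) =
    K * hessian_form sigma tau.
Proof.
move=> k_gt0; have [M M_gt0 scalM] := scal_unit_rescale.
exists (M * kappa ^- 2); first by rewrite mulr_gt0 // invr_gt0 exprn_gt0.
move=> sigma tau sum_sigma sum_tau; apply: has_hessianE.
pose x s t a := kappa + s * sigma a + t * tau a.
(* The monomial expression agrees with Sc only where all coordinates are positive, which holds near
   the origin. *)
apply: (@near_has_hessian _ (fun s t => M * scal_monomials (x s t))).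
  have : \forall s \near (0 : R), forall a, 0 < kappa + s * sigma a.
    apply: (@filter_forall R 'I_N (fun a s => 0 < kappa + s * sigma a)
      (nbhs (0 : R)) _) => a.
    exact: near0_affine_gt0.
  apply: filterS => s s_gt0.
  have : \forall t \near (0 : R), forall a, 0 < x s t a.
    apply: (@filter_forall R 'I_N (fun a t => 0 < x s t a) (nbhs (0 : R)) _) => a.
    exact: near0_affine_gt0.
  apply: filterS => t t_gt0; rewrite -scalM //; congr (scal (unit_rescale _ _)).
  by apply/matrixP => a b; rewrite !mxE /x !mulrnDl !mulrnAr.
pose h m : R := kappa ^- 2 * ((\sum_a m a * sigma a) * (\sum_a m a * tau a) -
                         \sum_a m a * (sigma a * tau a)).
have hess_mono m : \sum_a m a = 0 -> has_hessian (fun s t => monomial m (x s t)) (h m).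
  exact: has_hessian_monomial.
have invN1 : N%:R^-1 * (\sum_(e < N) (1 : R)) = 1.
  by rewrite sumr_const card_ord mulVf // pdim5_neq0.
have h1 b : has_hessian (fun s t => monomial (exponent1 b) (x s t)) (h (exponent1 b)).
  apply: hess_mono; have := sum_exponent1 b (fun=> 1 : R); rewrite invN1 subrr => sum0.
  by rewrite -[RHS]sum0; apply: eq_bigr => e _; rewrite mulr1.
have h2 a b c : has_hessian (fun s t => monomial (exponent2 a b c) (x s t))
                            (h (exponent2 a b c)).
  apply: hess_mono; have := sum_exponent2 a b c (fun=> 1 : R).
  rewrite invN1 addrK subrr => sum0.
  by rewrite -[RHS]sum0; apply: eq_bigr => e _; rewrite mulr1.
have H1 := has_hessianZ 10 (has_hessian_sum h1).
have H2 := has_hessianZ (- 4^-1) (has_hessian_sum (fun a => has_hessian_sum (fun b =>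
  has_hessian_sum (fun c => has_hessianZ (C a b c ^+ 2) (h2 a b c))))).
have := has_hessianZ M (has_hessianD H1 H2).
set H := (X in has_hessian _ X); set K := (X in _ -> has_hessian _ X).
suff -> : H = K.
  congr has_hessian; apply/funext => s; apply/funext => t.
  by rewrite /scal_monomials mulNr.
rewrite {}/H {}/K -mulrA; congr (_ * _).
set P := \sum_a sigma a * tau a; pose A := N%:R^-1 * P.
have NA : \sum_(e < N) A = P.
  by rewrite sumr_const card_ord -mulr_natl mulrA mulfV ?mul1r // pdim5_neq0.
have -> : \sum_b h (exponent1 b) = kappa ^- 2 * P.
  transitivity (\sum_b kappa ^- 2 * (2 * (sigma b * tau b) - A)).
    apply: eq_bigr => b _; rewrite /h (sum_exponent1 b sigma) (sum_exponent1 b tau).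
    rewrite (sum_exponent1 b (fun e => sigma e * tau e)) sum_sigma sum_tau !mulr0.
    by congr (_ * _); rewrite /A /P; ring.
  by rewrite -mulr_sumr sumrB -mulr_sumr NA; congr (_ * _); rewrite /P; ring.
(* The second-order logarithmic terms cancel: each of [A], c, a, b contributes 12 P, with signs +,
   +, -, -. *)
have -> : \sum_a \sum_b \sum_c C a b c ^+ 2 * h (exponent2 a b c) =
    kappa ^- 2 * (\sum_a \sum_b \sum_c C a b c ^+ 2 *
      ((sigma c - sigma a - sigma b) * (tau c - tau a - tau b))).
  have [SAa _ _] := structure_const_sum1 (fun=> A).
  have [SPa SPb SPc] := structure_const_sum1 (fun e => sigma e * tau e).
  rewrite NA in SAa; rewrite /= -/P in SAa SPa SPb SPc.
  transitivity (kappa ^- 2 * (\sum_a \sum_b \sum_c C a b c ^+ 2 *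
      ((sigma c - sigma a - sigma b) * (tau c - tau a - tau b)) -
      \sum_(a < N) \sum_(b < N) \sum_(c < N) C a b c ^+ 2 * A -
      \sum_a \sum_b \sum_c C a b c ^+ 2 * (sigma c * tau c) +
      \sum_a \sum_b \sum_c C a b c ^+ 2 * (sigma a * tau a) +
      \sum_a \sum_b \sum_c C a b c ^+ 2 * (sigma b * tau b))); last first.
    by rewrite SAa SPa SPb SPc; congr (_ * _); ring.
  rewrite -!sumrN -!big_split mulr_sumr; apply: eq_bigr => a _ /=.
  rewrite -!sumrN -!big_split mulr_sumr; apply: eq_bigr => b _ /=.
  rewrite -!sumrN -!big_split mulr_sumr; apply: eq_bigr => c _ /=.
  rewrite /h (sum_exponent2 a b c sigma) (sum_exponent2 a b c tau).
  rewrite (sum_exponent2 a b c (fun e => sigma e * tau e)) sum_sigma sum_tau !mulr0.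
  by rewrite -/P -/A; move: (C a b c) => k; ring.
(* The coefficients are 10 - 36/4 = 1 for [P] and 2/4 = 1/2 for the adjacency sum. *)
by rewrite structure_const_form /hessian_form -/P; field; rewrite gt_eqF.
Qed.
End Stability.

(** * The quadratic form on edge weights *)

Section FlagGraph.
Variable R : realType.
Local Notation N := (pdim 5).
Implicit Types (a b : 'I_N) (S : 'M[R]_N) (y z : 'I_5 * 'I_5 -> R) (u : 'I_5 -> R).

(** The sum s_i: restricting to pairs that start at [i] counts each edge at [i] once. *)
Definition vertex_sum y (i : 'I_5) : R := \sum_(a < N) (i == (pidx a).1)%:R * y (pidx a).

Lemma sum_pidx_swap (F : 'I_5 * 'I_5 -> R) :
  \sum_(a < N) F (swap (pidx a)) = \sum_(a < N) F (pidx a).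
Proof.
rewrite (sum_pidx (fun p => F (swap p))) sum_pidx.
rewrite [RHS](reindex_inj (h := @swap 'I_5)) /=; last by case=> ? ? [? ?] [-> ->].
by apply: eq_bigl => p; rewrite eq_sym.
Qed.

Lemma sum_vertex_sum y u :
  \sum_i u i * vertex_sum y i = \sum_(a < N) u (pidx a).1 * y (pidx a).
Proof.
under eq_bigr => i _ do rewrite mulr_sumr.
rewrite exchange_big; apply: eq_bigr => a _ /=.
rewrite -(sum_delta u (pidx a).1) mulr_suml; apply: eq_bigr => i _.
by rewrite mulrCA mulrA.
Qed.

(** Coincidences of endpoints number 1 for adjacent edges, 2 for the same edge in either
    orientation, and 0 for disjoint ones. *)
Lemma incidence a b :
  (((pidx a).1 == (pidx b).1) + ((pidx a).1 == (pidx b).2) +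
  (((pidx a).2 == (pidx b).1) + ((pidx a).2 == (pidx b).2)) =
  adjacent (pidx a) (pidx b) + 2 * ((pidx b == pidx a) + (pidx b == swap (pidx a))))%N.
Proof.
move: (pidx_neq a) (pidx_neq b); case: (pidx a) (pidx b) => i j [k l] /=.
rewrite /adjacent /swap !xpair_eqE -!val_eqE /=;
by move: (val i) (val j) (val k) (val l) => {}i {}j {}k {}l; lia.
Qed.

(** By symmetry of the weights all four incidence sums equal \sum_i s_i(y) s_i(z). With [incidence]
    the adjacency sum is 4 times this minus 4 \sum_a y_a z_a. *)
Lemma hessian_form_pair y z : sym_weight y -> sym_weight z ->
  hessian_form (fun a : 'I_N => y (pidx a)) (fun a => z (pidx a)) =
  2 * \sum_i vertex_sum y i * vertex_sum z i - \sum_(a < N) y (pidx a) * z (pidx a).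
Proof.
move=> y_sym z_sym.
pose G (p q : 'I_5 * 'I_5) : R := y p * z q.
have inc11 : \sum_(a < N) \sum_(b < N) ((pidx a).1 == (pidx b).1)%:R * G (pidx a) (pidx b) =
    \sum_i vertex_sum y i * vertex_sum z i.
  under [RHS]eq_bigr => i _ do rewrite mulrC.
  rewrite sum_vertex_sum; apply: eq_bigr => a _.
  by rewrite mulr_suml; apply: eq_bigr => b _; rewrite /G; ring.
have inc2 (i : 'I_5) p : \sum_(b < N) (i == (pidx b).2)%:R * G p (pidx b) =
    \sum_(b < N) (i == (pidx b).1)%:R * G p (pidx b).
  rewrite -(sum_pidx_swap (fun q => (i == q.1)%:R * G p q)).
  by apply: eq_bigr => b _; rewrite /G z_sym.
have inc21 : \sum_(a < N) \sum_(b < N) ((pidx a).2 == (pidx b).1)%:R * G (pidx a) (pidx b) =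
    \sum_(a < N) \sum_(b < N) ((pidx a).1 == (pidx b).1)%:R * G (pidx a) (pidx b).
  rewrite -(sum_pidx_swap (fun p => \sum_(b < N) (p.1 == (pidx b).1)%:R * G p (pidx b))).
  by apply: eq_bigr => a _; apply: eq_bigr => b _; rewrite /G y_sym.
have diag : \sum_(a < N) \sum_(b < N) (pidx b == pidx a)%:R * G (pidx a) (pidx b) =
    \sum_(a < N) y (pidx a) * z (pidx a).
  apply: eq_bigr => a _; rewrite -(sum_delta (fun b => y (pidx a) * z (pidx b)) a).
  by apply: eq_bigr => b _; rewrite (inj_eq (@pidx_inj 5)).
have diag_swap : \sum_(a < N) \sum_(b < N) (pidx b == swap (pidx a))%:R * G (pidx a) (pidx b) =
    \sum_(a < N) y (pidx a) * z (pidx a).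
  rewrite -diag -(sum_pidx_swap (fun p => \sum_(b < N) (pidx b == p)%:R * G p (pidx b))).
  by apply: eq_bigr => a _; apply: eq_bigr => b _; rewrite /G y_sym.
have : \sum_(a < N) \sum_(b < N) (adjacent (pidx a) (pidx b))%:R * G (pidx a) (pidx b) =
    4 * (\sum_i vertex_sum y i * vertex_sum z i) -
    4 * \sum_(a < N) y (pidx a) * z (pidx a).
  transitivity (\sum_(a < N) \sum_(b < N) (
      (((pidx a).1 == (pidx b).1)%:R + ((pidx a).1 == (pidx b).2)%:R +
       (((pidx a).2 == (pidx b).1)%:R + ((pidx a).2 == (pidx b).2)%:R)) *
      G (pidx a) (pidx b) -
      2 * (((pidx b == pidx a)%:R + (pidx b == swap (pidx a))%:R) *
           G (pidx a) (pidx b)))).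
    apply: eq_bigr => a _; apply: eq_bigr => b _.
    have /(congr1 (GRing.natmul (1 : R))) := incidence a b.
    by rewrite !(natrD, natrM) => ->; ring.
  under eq_bigr => a _ do rewrite sumrB -mulr_sumr.
  rewrite sumrB -mulr_sumr.
  have -> : \sum_(a < N) \sum_(b < N)
      (((pidx b == pidx a)%:R + (pidx b == swap (pidx a))%:R) * G (pidx a) (pidx b)) =
      2 * \sum_(a < N) y (pidx a) * z (pidx a).
    under eq_bigr => a _ do (under eq_bigr => b _ do rewrite mulrDl; rewrite big_split).
    by rewrite big_split /= diag diag_swap; ring.
  under eq_bigr => a _ do
    (under eq_bigr => b _ do rewrite 3!mulrDl; rewrite !big_split /= !inc2).
  by rewrite !big_split /= inc21 inc11; ring.
by rewrite /hessian_form /= => ->; field.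
Qed.

Lemma vertex_sum_total y : \sum_i vertex_sum y i = \sum_(a < N) y (pidx a).
Proof.
have := sum_vertex_sum y (fun=> 1).
by under eq_bigr do rewrite mul1r; under [RHS]eq_bigr do rewrite mul1r.
Qed.

Definition edge_sum u (p : 'I_5 * 'I_5) : R := u p.1 + u p.2.

Lemma edge_sum_sym u : sym_weight (edge_sum u).
Proof. by move=> p; rewrite /edge_sum addrC. Qed.

Lemma sum_edge_sum y u : sym_weight y ->
  \sum_(a < N) y (pidx a) * edge_sum u (pidx a) = 2 * \sum_i u i * vertex_sum y i.
Proof.
move=> y_sym; rewrite sum_vertex_sum.
under eq_bigr => a _ do rewrite mulrDr.
rewrite big_split /= -(sum_pidx_swap (fun p => y p * u p.2)) mulr_natl mulr2n.
by congr (_ + _); apply: eq_bigr => a _; rewrite ?y_sym mulrC.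
Qed.

Lemma vertex_sum_edge_sum u i : \sum_j u j = 0 -> vertex_sum (edge_sum u) i = 3 * u i.
Proof.
move=> sum_u; rewrite /vertex_sum (sum_pidx (fun p => (i == p.1)%:R * edge_sum u p)).
rewrite big_mkcond -(pair_bigA _ (fun j k => if j != k then
  (i == j)%:R * edge_sum u (j, k) else 0)) /= (bigD1 i) //=.
rewrite [X in _ + X]big1 => [|j nji]; last first.
  by apply: big1 => k _; rewrite (eq_sym i j) (negPf nji) mul0r if_same.
rewrite addr0 eqxx.
(* The missing term k = i is added and subtracted: 5 u_i + 0 - 2 u_i = 3 u_i. *)
transitivity (\sum_k (u i + u k - (k == i)%:R * (u k + u k))).
  apply: eq_bigr => k _; rewrite eq_sym /edge_sum mul1r /=.
  by case: eqVneq => [->|_] /=; rewrite ?mul1r ?mul0r ?subrr ?subr0.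
rewrite sumrB big_split /= sum_delta sum_u sumr_const card_ord -mulr_natl; ring.
Qed.

(** The factor 4 is 2 * 3 from the vertex sums 3 u, minus 2 from the pairing of [y] with
    [edge_sum u]. *)
Lemma hessian_form_edge_sum y u : sym_weight y -> \sum_j u j = 0 ->
  hessian_form (fun a : 'I_N => y (pidx a)) (fun a => edge_sum u (pidx a)) =
  4 * \sum_i u i * vertex_sum y i.
Proof.
move=> y_sym sum_u; rewrite hessian_form_pair //; last exact: edge_sum_sym.
rewrite sum_edge_sum //.
under eq_bigr => i _ do rewrite vertex_sum_edge_sum // mulrCA [_ * u i]mulrC.
by rewrite -mulr_sumr; ring.
Qed.
End FlagGraph.

(** * Invariant transverse traceless tensors as edge weights of total 0 *)

Section Transverse.
Variables (R : realType) (kappa : R).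
Hypothesis kappa_neq0 : kappa != 0.
Local Notation N := (pdim 5).
Local Notation g := (diag_form (fun=> kappa)).
Implicit Types (a b c : 'I_N) (S : 'M[R]_N) (y : 'I_5 * 'I_5 -> R) (u : 'I_5 -> R).

Lemma gtrace_pair_form y : gtrace g (pair_form y) = kappa^-1 * \sum_(a < N) y (pidx a).
Proof.
rewrite gtrace_diag_form // mulr_sumr; apply: eq_bigr => a _.
by rewrite diag_formE eqxx.
Qed.

(** Both terms of each diagonal entry of nabla S vanish: Lambda(e_a) e_a = 0, and Lambda(e_a) z has
    no e_a-component. *)
Lemma divergence_pair_form y z : divergence g (pair_form y) z = 0.
Proof.
rewrite /divergence gtrace_diag_form // big1 // => a _; rewrite mxE /nabla.
have -> : nomizu g (pbasis R a) (pbasis R a) = 0.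
  apply/rowP => c; rewrite nomizu_pbasis // sum_pbasis mxE.
  by rewrite /levi_civita structure_const0 !mul0r.
rewrite /form !mul0mx mxE oppr0 sub0r -/(form _ _ _) form_diag_form.
under eq_bigr => b _ do rewrite mulrAC mulrC.
rewrite sum_pbasis nomizu_pbasis // big1 ?mulr0 ?oppr0 ?mulr0 // => b _.
by rewrite levi_civita_diag mulr0.
Qed.

Lemma TT_pair_form y : sym_weight y -> \sum_(a < N) y (pidx a) = 0 ->
  TT g (pair_form y).
Proof.
move=> y_sym sum_y; split; first exact: pair_form_invariant.
  by rewrite gtrace_pair_form sum_y mulr0.
exact: divergence_pair_form.
Qed.

Lemma TT_weight S : TT g S ->
  [/\ sym_weight (weight S), S = pair_form (weight S) &
      \sum_(a < N) weight S (pidx a) = 0].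
Proof.
case=> S_inv tr0 _; split; [exact: weight_sym | exact: invariant_weight |].
move/eqP: tr0; rewrite [S in gtrace _ S]invariant_weight // gtrace_pair_form.
by rewrite mulf_eq0 invr_eq0 (negPf kappa_neq0) => /eqP.
Qed.

Lemma TT_edge_sum u : \sum_i u i = 0 -> TT g (pair_form (edge_sum u)).
Proof.
move=> sum_u; apply: TT_pair_form; first exact: edge_sum_sym.
rewrite -vertex_sum_total; under eq_bigr => i _ do rewrite vertex_sum_edge_sum //.
by rewrite -mulr_sumr sum_u mulr0.
Qed.

Lemma pair_form_eq0 y : (forall a, y (pidx a) = 0) -> pair_form y = 0.
Proof.
move=> y0; apply/matrixP => a b.
by rewrite diag_formE y0 mul0rn mxE.
Qed.

(* On the kernel of vertex_sum the Hessian is -K \sum_a y_a^2. *)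
Lemma vertex_sum0_eq0 y : sym_weight y -> (forall i, vertex_sum y i = 0) ->
  0 <= hessian_form (fun a : 'I_N => y (pidx a)) (fun a => y (pidx a)) ->
  pair_form y = 0.
Proof.
move=> y_sym y0; rewrite hessian_form_pair //.
under eq_bigr => i _ do rewrite y0 mulr0.
rewrite big1 // mulr0 sub0r oppr_ge0 => sum_le0.
apply: pair_form_eq0 => a; apply/eqP; rewrite -sqrf_eq0.
have : \sum_(b < N) y (pidx b) * y (pidx b) == 0.
  by rewrite eq_le sum_le0 sumr_ge0 // => b _; rewrite -expr2 sqr_ge0.
rewrite psumr_eq0 => [|b _]; last by rewrite -expr2 sqr_ge0.
by move=> /allP/(_ a (mem_index_enum _)).
Qed.

End Transverse.

(** * Linear coordinates on the 4-dimensional space of traceless vertex weights *)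

Section TracelessVertexWeights.
Variable R : realType.

(* Parametrizes the vertex weights u with \sum_i u_i = 0 by u_1, ..., u_4. *)
Definition traceless_vertex (r : 'rV[R]_4) (i : 'I_5) : R :=
  \sum_j r 0 j * ((i == lift ord0 j)%:R - (i == ord0)%:R).

Lemma sum_traceless_vertex r : \sum_i traceless_vertex r i = 0.
Proof.
rewrite exchange_big big1 // => j _; rewrite -mulr_sumr sumrB.
under eq_bigr do rewrite -[_%:R]mulr1.
under [X in _ - X]eq_bigr do rewrite -[_%:R]mulr1.
by rewrite !(sum_delta (fun=> 1)) subrr mulr0.
Qed.

Lemma traceless_vertexK r j : traceless_vertex r (lift ord0 j) = r 0 j.
Proof.
rewrite /traceless_vertex (bigD1 j) //= big1 => [|k nkj].
  by rewrite eqxx subr0 mulr1 addr0.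
rewrite (inj_eq (@lift_inj _ _)) eq_sym (negPf nkj).
by rewrite subr0 mulr0.
Qed.

Definition coord_tensor (r : 'rV[R]_4) : 'M[R]_(pdim 5) :=
  pair_form (edge_sum (traceless_vertex r)).

Lemma coord_tensor_is_linear : linear coord_tensor.
Proof.
move=> k r s; apply/matrixP => a b; rewrite /coord_tensor !mxE mulrnAr -mulrnDl.
congr (_ *+ _); rewrite /edge_sum /traceless_vertex mulrDr addrACA !mulr_sumr.
by congr (_ + _); rewrite -big_split; apply: eq_bigr => j _ /=; rewrite !mxE; ring.
Qed.

HB.instance Definition _ := GRing.isLinear.Build R 'rV[R]_4 'M[R]_(pdim 5) _
  coord_tensor coord_tensor_is_linear.

(** Vertex 0 is omitted: on traceless tensors its sum is minus the sum of the other four. *)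
Definition vertex_coord (S : 'M[R]_(pdim 5)) : 'rV[R]_4 :=
  \row_j vertex_sum (weight S) (lift ord0 j).

Lemma vertex_coord_is_linear : linear vertex_coord.
Proof.
move=> k S T; apply/rowP => j; rewrite !mxE mulr_sumr -big_split.
by apply: eq_bigr => a _ /=; rewrite !weight_pidx !mxE; ring.
Qed.

HB.instance Definition _ := GRing.isLinear.Build R 'M[R]_(pdim 5) 'rV[R]_4 _
  vertex_coord vertex_coord_is_linear.

Lemma coord_tensorK r : vertex_coord (coord_tensor r) = 3 *: r.
Proof.
apply/rowP => j; rewrite !mxE -(traceless_vertexK r j).
rewrite -vertex_sum_edge_sum ?sum_traceless_vertex //.
by apply: eq_bigr => a _; rewrite weight_pidx diag_formE eqxx.
Qed.

End TracelessVertexWeights.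

(** * Non-degeneracy, instability and coindex of the standard metric *)

Theorem proposition8p1 (R : realType) (V0 : R) (V0_gt0 : 0 < V0) :
  let gs := standard_metric R 5 in
  [/\ invariant_metric gs, einstein gs, G_nondegenerate V0 gs,
      G_unstable V0 gs & has_coindex V0 gs 4].
Proof.
move=> gs.
have [kappa k_gt0 g1E] := unit_rescale_standard V0_gt0.
have k_neq0 : kappa != 0 by rewrite gt_eqF.
have [K K_gt0 hessE] := scal_hessian_diag V0_gt0 k_gt0.
pose H S S' := scal_hessian V0 (unit_rescale V0 gs) S S'.
have H_pair y z :
    \sum_(a < pdim 5) y (pidx a) = 0 -> \sum_(a < pdim 5) z (pidx a) = 0 ->
    H (pair_form y) (pair_form z) =
    K * hessian_form (fun a : 'I_(pdim 5) => y (pidx a)) (fun a => z (pidx a)).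
  by move=> sum_y sum_z; rewrite /H g1E; apply: hessE.
have sum_edge (u : 'I_5 -> R) : \sum_i u i = 0 ->
    \sum_(a < pdim 5) edge_sum u (pidx a) = 0.
  move=> /(TT_edge_sum k_neq0)[_ /eqP + _]; rewrite gtrace_pair_form //.
  by rewrite mulf_eq0 invr_eq0 (negPf k_neq0) => /eqP.
have H_edge y u : sym_weight y -> \sum_(a < pdim 5) y (pidx a) = 0 -> \sum_i u i = 0 ->
    H (pair_form y) (pair_form (edge_sum u)) = K * (4 * \sum_i u i * vertex_sum y i).
  by move=> y_sym sum_y sum_u; rewrite H_pair ?sum_edge // hessian_form_edge_sum.
have H_edge_gt0 (u : 'I_5 -> R) i : \sum_i u i = 0 -> u i != 0 ->
    0 < H (pair_form (edge_sum u)) (pair_form (edge_sum u)).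
  move=> sum_u ui; rewrite H_edge ?sum_edge //; last exact: edge_sum_sym.
  under eq_bigr => j _ do rewrite vertex_sum_edge_sum // mulrCA -expr2.
  rewrite -mulr_sumr !mulr_gt0 // lt0r sumr_ge0 => [|j _]; last by rewrite sqr_ge0.
  rewrite andbT psumr_eq0 => [|j _]; last by rewrite sqr_ge0.
  by apply/allPn; exists i; rewrite ?mem_index_enum // sqrf_eq0.
have H_le0 S : TT (unit_rescale V0 gs) S -> (forall i, vertex_sum (weight S) i = 0) ->
    0 <= H S S -> S = 0.
  rewrite g1E => /(TT_weight k_neq0)[w_sym SE sum_w] w0 H_ge0.
  rewrite SE; apply: vertex_sum0_eq0 => //.
  by move: H_ge0; rewrite SE H_pair // -SE pmulr_rge0.
split.
- have -> : gs = pair_form (fun=> 20) by rewrite /gs standard_metricE scalar_diag_form.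
  split; first exact: pair_form_invariant.
  move=> v /rV0Pn[a va]; rewrite form_diag_form.
  under eq_bigr => b _ do rewrite -mulrA -expr2.
  rewrite -mulr_sumr mulr_gt0 // (bigD1 a) //= ltr_pwDl //.
    by rewrite lt0r sqrf_eq0 va sqr_ge0.
  by apply: sumr_ge0 => b _; rewrite sqr_ge0.
- exact: einstein_standard.
- move=> S TTS H0.
  have [w_sym SE sum_w] := TT_weight k_neq0 (eq_ind _ (fun g => TT g S) TTS _ g1E).
  have sum_v : \sum_i vertex_sum (weight S) i = 0 by rewrite vertex_sum_total.
  (* [S] is tested against the edge weights built from its own vertex sums s; the pairing is 4 K
     \sum_i s_i^2, so s = 0. *)
  have TTv : TT (unit_rescale V0 gs) (pair_form (edge_sum (vertex_sum (weight S)))).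
    by rewrite g1E; have := TT_edge_sum k_neq0 sum_v.
  apply: (H_le0 S TTS); last by rewrite /H H0.
  move=> i; have := H_edge _ _ w_sym sum_w sum_v; rewrite -SE /H H0 // => /esym/eqP.
  rewrite !mulf_eq0 gt_eqF // pnatr_eq0 /=.
  rewrite psumr_eq0 => [|j _]; last by rewrite -expr2 sqr_ge0.
  by move=> /allP/(_ i (mem_index_enum _)); rewrite -expr2 sqrf_eq0 => /eqP.
- pose u (i : 'I_5) : R := (i == ord0)%:R - (i == ord_max)%:R.
  have sum_u : \sum_i u i = 0.
    by rewrite /u !big_ord_recl big_ord0 /=; ring.
  exists (pair_form (edge_sum u)).
    by rewrite /= g1E; have := TT_edge_sum k_neq0 sum_u.
  by apply: (H_edge_gt0 u ord0) => //; rewrite /u /= subr0 oner_eq0.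
- split.
  + exists (limg (linfun (@coord_tensor R))).
      split=> [S /memv_imgP[r _ ->]|S /memv_imgP[r _ ->]].
        rewrite lfunE /= g1E /coord_tensor.
        by have := TT_edge_sum k_neq0 (sum_traceless_vertex r).
      rewrite lfunE /= => phi_neq0; have [j rj] : exists j, r 0 j != 0.
        apply/rV0Pn; apply: contraNneq phi_neq0 => ->.
        by rewrite raddf0.
      rewrite /coord_tensor.
      apply: (H_edge_gt0 _ (lift ord0 j)); first exact: sum_traceless_vertex.
      by rewrite traceless_vertexK.
    rewrite limg_dim_eq; first by rewrite dimvf /dim /= mul1n.
    apply/eqP; rewrite capfv; apply/lker0P => r s.
    (* [vertex_coord] inverts [coord_tensor] up to the factor 3, so the image has dimension 4. *)
    rewrite !lfunE /= => /(congr1 (@vertex_coord R)); rewrite !coord_tensorK.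
    by apply: scalerI; rewrite pnatr_eq0.
  + move=> V [V_TT V_pos].
    have := limg_ker_dim (linfun (@vertex_coord R)) V.
    (* A trivial kernel on [V] embeds it into R^4. In the kernel four vertex sums vanish, the fifth
       follows from the trace, and [H_le0] then contradicts positivity. *)
    have -> : (V :&: lker (linfun (@vertex_coord R)))%VS = 0%VS.
      apply/eqP; rewrite -subv0; apply/subvP => S.
      rewrite memv_cap memv_ker lfunE memv0.
      case/andP => SV /eqP psi0; apply: contraT => S_neq0.
      have S_TT := V_TT _ SV.
      have sumw : \sum_i vertex_sum (weight S) i = 0.
        have [_ _ sum_w] := TT_weight k_neq0 (eq_ind _ (fun g => TT g S) S_TT _ g1E).
        by rewrite vertex_sum_total.
      have w0 j : vertex_sum (weight S) (lift ord0 j) = 0.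
        by have /rowP/(_ j) := psi0; rewrite !mxE.
      move: sumw; rewrite big_ord_recl big1 ?addr0 // => sumw.
      suff S0 : S = 0 by rewrite S0 eqxx in S_neq0.
      apply: (H_le0 S S_TT) => [i|]; last by rewrite ltW // V_pos.
      by case: (unliftP ord0 i) => [j ->|->].
    rewrite dimv0 add0n => <-.
    by apply: leq_trans (dimvS (subvf _)) _; rewrite dimvf /dim /= mul1n.
Qed.
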